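(* Let $M$ be a $2$-quasi-umbilical hypersurface isometrically immersed in a semi-Riemannian space of constant curvature $N_s^{n+1}(c)$, $n=\dim M\geq4$, where $c=\frac{\widetilde\kappa}{n(n+1)}$ and $\widetilde\kappa$ is the scalar curvature of $N_s^{n+1}(c)$. Then on ${\mathcal U}_S\cap{\mathcal U}_C\subset M$ $$C\cdot R+R\cdot C=Q(S,C)+\Big(L_C-\frac{(n-2)\widetilde\kappa}{n(n+1)}\Big)Q(g,C)-\frac1{(n-2)^2}\,Q\Big(g,\frac{n-2}2\,S\wedge S-\kappa\,g\wedge S+g\wedge S^2\Big),$$ where $L_C$ is the function for which $C\cdot C=L_C\,Q(g,C)$.
   Context: All manifolds are connected, paracompact and of class $C^\infty$. $N_s^{n+1}(c)$ is an $(n+1)$-dimensional semi-Riemannian space of constant sectional curvature $c$ with signature $(s,n+1-s)$; $g$ is the induced (non-degenerate) metric on $M$ and $H$ its second fundamental tensor. $M$ is $2$-quasi-umbilical if at each point $\mathrm{rank}(H-\alpha g)=2$ for some $\alpha\in\mathbb R$. It is known that every such hypersurface satisfies $C\cdot C=L_C\,Q(g,C)$ on ${\mathcal U}_C$ for some function $L_C$. For a semi-Riemannian manifold $(M,g)$, $n=\dim M$, with Levi-Civita connection $\nabla$: ${\mathcal R}(X,Y)Z=\nabla_X\nabla_YZ-\nabla_Y\nabla_XZ-\nabla_{[X,Y]}Z$, $R(X_1,X_2,X_3,X_4)=g({\mathcal R}(X_1,X_2)X_3,X_4)$, $S(X,Y)=\mathrm{tr}\{Z\mapsto{\mathcal R}(Z,X)Y\}$,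 $g({\mathcal S}X,Y)=S(X,Y)$, $S^2(X,Y)=S({\mathcal S}X,Y)$, $\kappa=\mathrm{tr}\,{\mathcal S}$. For symmetric $(0,2)$-tensors $E,F$: $(E\wedge F)(X_1,X_2,X_3,X_4)=E(X_1,X_4)F(X_2,X_3)+E(X_2,X_3)F(X_1,X_4)-E(X_1,X_3)F(X_2,X_4)-E(X_2,X_4)F(X_1,X_3)$; $G=\frac12g\wedge g$; $C=R-\frac1{n-2}g\wedge S+\frac\kappa{(n-2)(n-1)}G$ is the Weyl tensor. For $B\in\{R,C\}$ define ${\mathcal B}$ by $g({\mathcal B}(X_1,X_2)X_3,X_4)=B(X_1,X_2,X_3,X_4)$; for a $(0,k)$-tensor $T$, $(B\cdot T)(X_1,\dots,X_k,X,Y)=-\sum_iT(X_1,\dots,{\mathcal B}(X,Y)X_i,\dots,X_k)$. For a symmetric $(0,2)$-tensor $A$, $(X\wedge_AY)Z=A(Y,Z)X-A(X,Z)Y$ and $Q(A,T)(X_1,\dots,X_k,X,Y)=-\sum_iT(X_1,\dots,(X\wedge_AY)X_i,\dots,X_k)$. ${\mathcal U}_S$ is the set of points where $S\ne\frac\kappa ng$; ${\mathcal U}_C$ is the set of points where $C\neq0$. *)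

(* Defs.v *)
From HB Require Import structures.
From mathcomp Require Import all_boot all_order all_algebra ring.
From mathcomp Require Import boolp classical_sets functions cardinality reals.
From mathcomp Require Import topology normedtype derive.

Set Implicit Arguments.
Unset Strict Implicit.
Unset Printing Implicit Defensive.

Import Order.TTheory GRing.Theory Num.Theory.
Import numFieldNormedType.Exports.
Local Open Scope classical_set_scope.
Local Open Scope ring_scope.

(** * Smooth manifolds *)

(* C^oo on U: every iterated partial derivative is (totally) differentiable at
   every point of U.  Only used for open U. *)
Definition iter_partial (R : realType) (n : nat) (W : normedModType R)
    (s : seq 'I_n) (h : 'rV[R]_n -> W) : 'rV[R]_n -> W :=
  foldr (fun i k x => 'D_(delta_mx 0 i) k x) h s.

Definition smooth_on (R : realType) (n : nat) (W : normedModType R)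
    (U : set 'rV[R]_n) (h : 'rV[R]_n -> W) : Prop :=
  forall (s : seq 'I_n) x, U x -> differentiable (iter_partial s h) x.

Definition paracompact (T : topologicalType) : Prop :=
  forall U : set (set T),
    (forall A, U A -> open A) -> \bigcup_(A in U) A = [set: T] ->
  exists V : set (set T),
    [/\ forall B, V B -> open B,
        \bigcup_(B in V) B = [set: T],
        forall B, V B -> exists2 A, U A & B `<=` A
      & forall x : T, exists2 W, nbhs x W & finite_set [set B | V B /\ B `&` W !=set0]].

(* Both maps are total; [chart_map] is only meaningful on [chart_dom], and
   [chart_inv] only on the image of [chart_dom]. *)
Record chart (R : realType) (n : nat) (T : topologicalType) := Chart {
  chart_dom : set T;
  chart_map :> T -> 'rV[R]_n;
  chart_inv : 'rV[R]_n -> T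
}.

Definition is_chart (R : realType) (n : nat) (T : topologicalType)
    (phi : chart R n T) : Prop :=
  [/\ open (chart_dom phi),
      open (phi @` chart_dom phi),
      forall p, chart_dom phi p -> chart_inv phi (phi p) = p,
      forall p, chart_dom phi p -> {for p, continuous phi}
    & forall x, (phi @` chart_dom phi) x -> {for x, continuous (chart_inv phi)}].

Record manifold (R : realType) (n : nat) := Manifold {
  carrier :> topologicalType;
  atlas : set (chart R n carrier);
  atlas_chart : forall phi, atlas phi -> is_chart phi;
  atlas_cover : forall p : carrier, exists2 phi, atlas phi & chart_dom phi p;
  atlas_smooth : forall phi psi, atlas phi -> atlas psi ->
    smooth_on (phi @` (chart_dom phi `&` chart_dom psi)) (psi \o chart_inv phi);
  carrier_hausdorff : hausdorff_space carrier;
  carrier_connected : connected [set: carrier];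
  carrier_nonempty : [set: carrier] !=set0;
  carrier_paracompact : paracompact carrier
}.

(* [P] holds at [p] in every chart of the atlas around [p]; the second argument
   of [P] is the coordinate vector of [p].  All the [P] used below are invariant
   under changes of charts. *)
Definition at_point (R : realType) (n : nat) (M : manifold R n) (p : M)
    (P : chart R n M -> 'rV[R]_n -> Prop) : Prop :=
  forall phi : chart R n M, atlas phi -> chart_dom phi p -> P phi (phi p).

(** * Semi-Riemannian metrics *)

(* Vectors are row vectors of components, so that ['J h x] acts on the right and
   the pull-back of a Gram matrix [A] is [J *m A *m J^T]. *)
Record metric (R : realType) (n : nat) (M : manifold R n) := Metric {
  gram :> chart R n M -> 'rV[R]_n -> 'M[R]_n;
  gram_smooth : forall phi, atlas phi ->
    smooth_on (phi @` chart_dom phi) (gram phi);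
  gram_sym : forall p, at_point p (fun phi x => (gram phi x)^T = gram phi x);
  gram_unit : forall p, at_point p (fun phi x => gram phi x \in unitmx);
  gram_change : forall (phi psi : chart R n M) p, atlas phi -> atlas psi ->
    chart_dom phi p -> chart_dom psi p ->
    let J := 'J (psi \o chart_inv phi) (phi p) in
    gram phi (phi p) = J *m gram psi (psi p) *m J^T
}.

Definition bform (R : realType) (n : nat) (A : 'M[R]_n) (u v : 'rV[R]_n) : R :=
  (u *m A *m v^T) 0 0.

(* The vector dual to the covector [w]: bform A (sharp A w) v = w v. *)
Definition sharp (R : realType) (n : nat) (A : 'M[R]_n) (w : 'rV[R]_n -> R) :
    'rV[R]_n :=
  (\row_l w (delta_mx 0 l)) *m invmx A.

(** * Levi-Civita connection and curvature, in a coordinate domain with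
    Gram matrix [g] *)

Section Local.
Variables (R : realType) (n : nat).
Notation V := 'rV[R]_n.
Implicit Types (g : V -> 'M[R]_n) (x u v w z : V) (X Y Z : V -> V).

(* Koszul formula for constant vector fields *)
Definition christoffel g x u v : V :=
  sharp (g x) (fun w => 2^-1 *
    ('D_u (fun y => bform (g y) v w) x
     + 'D_v (fun y => bform (g y) u w) x
     - 'D_w (fun y => bform (g y) u v) x)).

Definition nabla g X Y : V -> V :=
  fun x => 'D_(X x) Y x + christoffel g x (X x) (Y x).

Definition lie_bracket X Y : V -> V :=
  fun x => 'D_(X x) Y x - 'D_(Y x) X x.

Definition curvature_field g X Y Z : V -> V := fun x =>
  nabla g X (nabla g Y Z) x - nabla g Y (nabla g X Z) x
  - nabla g (lie_bracket X Y) Z x.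

(* The value at [x] only depends on the values of the fields at [x], so they are
   extended as constant fields. *)
Definition curvature g x u v w : V :=
  curvature_field g (cst u) (cst v) (cst w) x.

Definition riem g x u v w z : R := bform (g x) (curvature g x u v w) z.

Definition ricci g x u v : R := \tr (lin1_mx (fun z => curvature g x z u v)).

Definition ricci_op g x u : V := sharp (g x) (ricci g x u).

Definition ricci_sq g x u v : R := ricci g x (ricci_op g x u) v.

Definition scal g x : R := \tr (lin1_mx (ricci_op g x)).

End Local.

(* [christoffel] is the torsion-free metric connection. *)

Lemma bform_sharp (R : realType) (n : nat) (A : 'M[R]_n) (w : 'rV[R]_n -> R) v :
  A \in unitmx -> linear_for *%R w -> bform A (sharp A w) v = w v.
Proof.
move=> Au wlin; rewrite /bform /sharp mulmxKV // mxE [in RHS](row_sum_delta v).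
pose wl : {linear 'rV[R]_n -> R | *%R} := HB.pack w (GRing.isLinear.Build R _ _ _ w wlin).
rewrite -[w (\sum_j _)]/(wl _) linear_sum; apply: eq_bigr => j _.
by rewrite linearZ /= !mxE mulrC.
Qed.

Lemma bform_sym (R : realType) (n : nat) (A : 'M[R]_n) u v :
  A^T = A -> bform A u v = bform A v u.
Proof.
move=> As; rewrite /bform -[in LHS](trmxK (u *m A *m v^T)) mxE.
by rewrite !trmx_mul trmxK As mulmxA.
Qed.

Section LeviCivita.
Variables (R : realType) (n : nat) (g : 'rV[R]_n -> 'M[R]_n) (x : 'rV[R]_n).
Hypothesis g_sym : \forall y \near x, (g y)^T = g y.
Hypothesis g_unit : g x \in unitmx.
Hypothesis g_diff : differentiable g x.

Let bform_diff v w : differentiable (fun y => bform (g y) v w) x.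
Proof.
have -> : (fun y => bform (g y) v w) = (fun A => bform A v w) \o g by [].
apply: differentiable_comp => //.
have -> : (fun A : 'M[R]_n => bform A v w)
    = \sum_i \sum_j (fun A : 'M[R]_n => (v 0 i * w 0 j) *: A i j).
  apply/funext => A; rewrite /bform !fct_sumE mxE.
  under [RHS]eq_bigr do rewrite fct_sumE.
  rewrite [RHS]exchange_big /=; apply: eq_bigr => j _; rewrite !mxE mulr_suml.
  by apply: eq_bigr => i _; rewrite /GRing.scale /=; ring.
apply: differentiable_sum => i; apply: differentiable_sum => j.
by apply: differentiableZ; exact: differentiable_coord.
Qed.

Let D_sym u v w : 'D_u (fun y => bform (g y) v w) x = 'D_u (fun y => bform (g y) w v) x.
Proof.
have [->|u0] := eqVneq u 0; first by rewrite !deriveE // !linear0.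
apply: near_eq_derive => //; near=> y; apply: bform_sym; near: y; exact: g_sym.
Unshelve. all: by end_near. Qed.

Let bform_linr A v : linear_for *%R (@bform R n A v).
Proof.
move=> a b c; rewrite /bform linearP /= mulmxDr mxE.
by rewrite -scalemxAr mxE.
Qed.

Let D_linr u v : linear_for *%R (fun w => 'D_u (fun y => bform (g y) v w) x).
Proof.
move=> a b c.
under eq_fun do rewrite bform_linr.
rewrite -[fun y => _]/((a \*: (fun y => bform (g y) v b)) + (fun y => bform (g y) v c)).
rewrite deriveD ?deriveZ //.
- by apply: diff_derivable; exact: bform_diff.
- by apply: derivableZ; apply: diff_derivable; exact: bform_diff.
- by apply: diff_derivable; exact: bform_diff.
Qed.

Let D_linl v w : linear_for *%R (fun u => 'D_u (fun y => bform (g y) v w) x).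
Proof. by move=> a b c; rewrite !deriveE ?linearP //; exact: bform_diff. Qed.

Lemma bform_christoffel u v w :
  bform (g x) (christoffel g x u v) w = 2^-1 *
    ('D_u (fun y => bform (g y) v w) x
     + 'D_v (fun y => bform (g y) u w) x
     - 'D_w (fun y => bform (g y) u v) x).
Proof.
apply: bform_sharp => // a b c.
by rewrite (D_linr u v) (D_linr v u) (D_linl u v); ring.
Qed.

Lemma christoffelC u v : christoffel g x u v = christoffel g x v u.
Proof.
rewrite /christoffel; congr sharp; apply/funext => w; congr (_ * _).
by rewrite (D_sym w u v); congr (_ - _); rewrite addrC.
Qed.

Lemma christoffel_metric u v w :
  'D_u (fun y => bform (g y) v w) x
  = bform (g x) (christoffel g x u v) w + bform (g x) v (christoffel g x u w).
Proof.
rewrite (@bform_sym _ _ _ v); last exact: nbhs_singleton g_sym.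
rewrite !bform_christoffel (D_sym u w) (D_sym w u) (D_sym v u).
by field.
Qed.
End LeviCivita.

(** * Tensor algebra *)

Section Tensors.
Variables (R : realType) (n : nat).
Notation V := 'rV[R]_n.
Notation tensor2 := (V -> V -> R).
Notation tensor4 := (V -> V -> V -> V -> R).

Definition wedge (E F : tensor2) : tensor4 := fun X1 X2 X3 X4 =>
  E X1 X4 * F X2 X3 + E X2 X3 * F X1 X4 - E X1 X3 * F X2 X4 - E X2 X4 * F X1 X3.

Definition Gtensor (E : tensor2) : tensor4 := fun X1 X2 X3 X4 =>
  2^-1 * wedge E E X1 X2 X3 X4.

Definition weyl (g : V -> 'M[R]_n) (x : V) : tensor4 := fun X1 X2 X3 X4 =>
  riem g x X1 X2 X3 X4
  - (n%:R - 2)^-1 * wedge (bform (g x)) (ricci g x) X1 X2 X3 X4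
  + scal g x / ((n%:R - 2) * (n%:R - 1)) * Gtensor (bform (g x)) X1 X2 X3 X4.

(* The common pattern of B.T and Q(A,T): the family of endomorphisms [D X Y]
   acts as a derivation on T, with X and Y as the last two arguments. *)
Definition act4 (D : V -> V -> V -> V) (T : tensor4) :
    V -> V -> V -> V -> V -> V -> R :=
  fun X1 X2 X3 X4 X Y =>
  - (T (D X Y X1) X2 X3 X4 + T X1 (D X Y X2) X3 X4
     + T X1 X2 (D X Y X3) X4 + T X1 X2 X3 (D X Y X4)).

(* B.T, where A is the Gram matrix used to raise the last index of B *)
Definition cdot (A : 'M[R]_n) (B T : tensor4) :=
  act4 (fun X Y Z => sharp A (B X Y Z)) T.

Definition Qt (A : tensor2) (T : tensor4) :=
  act4 (fun X Y Z => A Y Z *: X - A X Z *: Y) T.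

End Tensors.

(** * Spaces of constant curvature *)

Section ConstantCurvature.
Variables (R : realType) (n : nat) (M : manifold R n) (g : metric M).

(* constant index s: signature (s, n - s), with the s minus signs first *)
Definition has_index (s : nat) : Prop :=
  (s <= n)%N /\
  forall p : M, at_point p (fun phi x =>
    exists2 P : 'M[R]_n, P \in unitmx &
      P *m g phi x *m P^T = diag_mx (\row_i (if (i < s)%N then -1 else 1))).

(* every nondegenerate tangent plane has sectional curvature c *)
Definition has_constant_curvature (c : R) : Prop :=
  forall p : M, at_point p (fun phi x => forall u v : 'rV[R]_n,
    Gtensor (bform (g phi x)) u v v u != 0 ->
    riem (g phi) x u v v u / Gtensor (bform (g phi x)) u v v u = c).

Definition has_scalar_curvature (k : R) : Prop :=
  forall p : M, at_point p (fun phi x => scal (g phi) x = k).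

Definition US : set M := [set p | ~ at_point p (fun phi x =>
  forall u v, ricci (g phi) x u v = scal (g phi) x / n%:R * bform (g phi x) u v)].

Definition UC : set M := [set p | ~ at_point p (fun phi x =>
  forall X1 X2 X3 X4, weyl (g phi) x X1 X2 X3 X4 = 0)].

End ConstantCurvature.

(** * Hypersurfaces *)

Section Hypersurfaces.
Variables (R : realType) (n m : nat) (M : manifold R n) (N : manifold R m).
Variables (g : metric M) (gN : metric N) (f : M -> N).

Definition coord_rep (phi : chart R n M) (psi : chart R m N) :
    'rV[R]_n -> 'rV[R]_m :=
  psi \o f \o chart_inv phi.

Definition isometric_immersion : Prop :=
  continuous f /\
  forall phi psi, atlas phi -> atlas psi ->
    let F := coord_rep phi psi in
    smooth_on (phi @` (chart_dom phi `&` f @^-1` chart_dom psi)) F /\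
    forall p, chart_dom phi p -> chart_dom psi (f p) ->
      let J := 'J F (phi p) in
      row_free J /\ g phi (phi p) = J *m gN psi (psi (f p)) *m J^T.

Definition unit_normal (gt : 'rV[R]_m -> 'M[R]_m) (F : 'rV[R]_n -> 'rV[R]_m)
    (x : 'rV[R]_n) (xi : 'rV[R]_m) : Prop :=
  (bform (gt (F x)) xi xi = 1 \/ bform (gt (F x)) xi xi = -1) /\
  forall u, bform (gt (F x)) ('D_u F x) xi = 0.

(* H(d_i, d_j) is the inner product with xi of the ambient covariant derivative
   of the vector field dF(d_j) (along F) in the direction d_i; equivalently,
   the ambient derivative is nabla + g(xi,xi) H xi. *)
Definition second_form (gt : 'rV[R]_m -> 'M[R]_m) (F : 'rV[R]_n -> 'rV[R]_m)
    (x : 'rV[R]_n) (xi : 'rV[R]_m) : 'M[R]_n :=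
  \matrix_(i, j)
    let ei := delta_mx 0 i in let ej := delta_mx 0 j in
    bform (gt (F x))
      ('D_ei (fun y => 'D_ej F y) x
       + christoffel gt (F x) ('D_ei F x) ('D_ej F x)) xi.

(* H is determined up to sign (the choice of xi), hence so is alpha. *)
Definition quasi_umbilical (k : nat) : Prop :=
  forall p : M, at_point p (fun phi x => at_point (f p) (fun psi _ =>
    let F := coord_rep phi psi in
    exists (xi : 'rV[R]_m) (alpha : R),
      unit_normal (gN psi) F x xi /\
      \rank (second_form (gN psi) F x xi - alpha *: g phi x) = k)).

End Hypersurfaces.

(* Main.v *)
Require Import Defs.
From HB Require Import structures.
From mathcomp Require Import all_boot all_order all_algebra ring lra.
From mathcomp Require Import boolp classical_sets functions reals.
From mathcomp Require Import topology normedtype landau derive.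

Set Implicit Arguments.
Unset Strict Implicit.
Unset Printing Implicit Defensive.

Import Order.TTheory GRing.Theory Num.Theory.
Import numFieldNormedType.Exports.
Local Open Scope classical_set_scope.
Local Open Scope ring_scope.

(* The Gauss equation is obtained without extending the normal field: if [A v w] is
   the ambient covariant derivative of [dF w] along [v], then
   g(Gamma v w, z) = gN(A v w, dF z), and differentiating this identity once more
   compares the two curvature tensors.  With e = gN(xi, xi) it gives
   R = c G + (e/2) H /\ H and S = (n - 1) c g + e (tr(H) H - H^2), from which
   R.R = Q(S, R) - (n - 2) c Q(g, C).
   Put E = R - C = (n - 2)^-1 g /\ S - kappa ((n - 2) (n - 1))^-1 G.  By bilinearity
   C.R + R.C = R.R + C.C - E.E, where C.C = L_C Q(g, C), and E.E is computed from
   (g /\ S).(g /\ S) = Q(g, g /\ S^2), G.(g /\ S) = Q(g, g /\ S) and E.G = 0.  The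
   rest follows from Q(S, g /\ S) = - 1/2 Q(g, S /\ S) and Q(S, G) = - Q(g, g /\ S). *)

(** * Derivatives of matrix-valued maps *)

(** Quasi-umbilicity provides a unit normal at each single point, with no smoothness in the point.
    This is why no derivative of a normal may enter: [xi] is used only at the point itself, to split
    [A v w] there into tangential and normal part. A second obstacle is that constant sectional
    curvature speaks of nondegenerate planes only, so the full ambient curvature tensor has to be
    recovered by a density argument. The mixed products R.E and E.R are never evaluated: they enter
    C.R + R.C with the same coefficients as C.C, and C.C is given. Once R and S are expressed by g,
    H and H^2 at one point, every remaining identity is polynomial in the values of symmetric
    bilinear forms. *)

Lemma derive_linear (R : realType) (V W : normedModType R) (h : V -> W) x :
  differentiable h x -> linear (fun u => 'D_u h x).
Proof. by move=> dh a u v; rewrite !deriveE // linearP. Qed.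

Lemma derive_comp (R : realType) (U V W : normedModType R) (F : U -> V)
    (h : V -> W) x u :
  differentiable F x -> differentiable h (F x) ->
  'D_u (h \o F) x = 'D_('D_u F x) h (F x).
Proof.
move=> dF dh; rewrite [LHS]deriveE; last exact: differentiable_comp.
by rewrite diff_comp //= !deriveE.
Qed.

Lemma derive_entry (R : realType) (V : normedModType R) (m n : nat)
    (A : V -> 'M[R]_(m, n)) x u i j :
  differentiable A x -> 'D_u (fun y => A y i j) x = 'D_u A x i j.
Proof. by move=> dA; rewrite derive_mx ?mxE //; exact: diff_derivable. Qed.

Lemma differentiable_entry (R : realType) (V : normedModType R) (m n : nat)
    (A : V -> 'M[R]_(m, n)) x i j :
  differentiable A x -> differentiable (fun y => A y i j) x.
Proof.
move=> dA; apply: (@differentiable_comp _ _ _ _ A (fun B : 'M[R]_(m, n) => B i j)) => //.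
exact: differentiable_coord.
Qed.

Lemma differentiable_mx (R : realType) (V : normedModType R) (m n : nat)
    (A : V -> 'M[R]_(m, n)) x :
  (forall i j, differentiable (fun y => A y i j) x) -> differentiable A x.
Proof.
move=> dA; have -> : A = \sum_i \sum_j (fun y => A y i j *: delta_mx i j).
  apply/funext => y; rewrite fct_sumE [LHS]matrix_sum_delta.
  by apply: eq_bigr => i _; rewrite fct_sumE.
apply: differentiable_sum => i; apply: differentiable_sum => j.
exact: differentiableZl.
Qed.

Lemma is_derive_line (R : realType) (V : normedModType R) (h : V -> R) u w (s : R) :
  differentiable h (s *: u + w) ->
  is_derive s 1 (fun r => h (r *: u + w)) ('D_u h (s *: u + w)).
Proof.
move=> dh; pose l (r : R) := r *: u + w.
have dl : differentiable l s.
  by apply: differentiableD; [exact: differentiableZl | exact: differentiable_cst].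
have Dl : 'D_1 l s = u.
  rewrite -[l]/((fun r : R => r *: u) + cst w) deriveD //; last first.
    by apply: diff_derivable; exact: differentiableZl.
  rewrite derive_cst addr0 deriveE; last exact: differentiableZl.
  by rewrite diffZl // diff_val scale1r.
have dhl : differentiable (h \o l) s by exact: differentiable_comp.
split; first exact: diff_derivable.
by rewrite -[fun r => _]/(h \o l) derive_comp // Dl.
Qed.

(** * Symmetry of second derivatives *)

Section Schwarz.
Variables (R : realType) (V : normedModType R) (x : V).

Let second_difference (h : V -> R) (u v : V) (t : R) : R :=
  h (t *: u + t *: v + x) - h (t *: u + x) - h (t *: v + x) + h x.

(* Mean value theorem in the direction [u], then first order expansion of ['D_u h]. *)
Let second_difference_approx (h : V -> R) (u v : V) (e : R) :
  (\forall y \near x, differentiable h y) -> differentiable ('D_u h) x -> 0 < e ->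
  \forall t \near 0^'+,
    `|second_difference h u v t - t * t * 'D_v ('D_u h) x|
      <= e * (t * t) * (2 * (`|u| + `|v|)).
Proof.
move=> dh dp e0; set p := 'D_u h in dp *.
have [r /= r0 Hr] : exists2 r : R, 0 < r & forall k, `|k| < r ->
    differentiable h (k + x) /\ `|p (k + x) - p x - 'd p x k| <= e * `|k|.
  suff /nbhs_norm0P[r r0 Hr] : \forall k \near (0 : V), differentiable h (k + x) /\
      `|p (k + x) - p x - 'd p x k| <= e * `|k| by exists r.
  have /eqaddoP/(_ _ e0) Hp := diff_locally dp.
  near=> k; split.
    by near: k; move: dh; rewrite (near_shift 0) subr0.
  have -> : p (k + x) - p x - 'd p x k =
    (p \o shift x - (cst (p x) + 'd p x)) k by rewrite /= opprD addrA.
  by near: k; exact: Hp.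
pose N := `|u| + `|v|.
have N0 : 0 <= N by rewrite addr_ge0.
near=> t.
have t0 : 0 < t by near: t; exact: nbhs_right_gt.
have tN : t * N < r.
  have : t < r / (N + 1) by near: t; apply: nbhs_right_lt; rewrite divr_gt0 // ltr_wpDl.
  by rewrite ltr_pdivlMr ?ltr_wpDl // mulrDr mulr1; lra.
(* The second difference is [ph t - ph 0]. The derivative of [ph] compares [p] at two points that
   differ by [t *: v]; in the first order expansions the terms along [u] cancel and [t] times the
   derivative along [v] is left. *)
pose ph (s : R) := h (s *: u + (t *: v + x)) - h (s *: u + x).
have small (s : R) : 0 <= s <= t -> `|s *: u| <= t * `|u| /\ `|s *: u + t *: v| <= t * N.
  move=> /andP[s0 st].
  have E : `|s *: u| <= t * `|u| by rewrite normrZ ger0_norm // ler_wpM2r.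
  split => //; apply: (le_trans (ler_normD _ _)); rewrite /N mulrDr lerD //.
  by rewrite normrZ gtr0_norm.
have small1 (s : R) : 0 <= s <= t -> `|s *: u| < r.
  move=> /small[E _]; apply: le_lt_trans E _; apply: le_lt_trans tN.
  by rewrite ler_pM2l // lerDl.
have small2 (s : R) : 0 <= s <= t -> `|s *: u + t *: v| < r.
  by move=> /small[_ E]; apply: le_lt_trans E tN.
have dph (s : R) : 0 <= s <= t ->
    is_derive s 1 ph (p (s *: u + (t *: v + x)) - p (s *: u + x)).
  move=> st; apply: is_deriveB.
    by apply: is_derive_line; rewrite addrA; exact: (Hr _ (small2 _ st)).1.
  by apply: is_derive_line; exact: (Hr _ (small1 _ st)).1.
have [||s] := @MVT_segment R ph (fun s => p (s *: u + (t *: v + x)) - p (s *: u + x)) 0 t (ltW t0).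
- by move=> s; rewrite in_itv /= => /andP[s0 st]; apply: dph; rewrite !ltW.
- apply: derivable_within_continuous => s; rewrite in_itv /= => st.
  by have [] := dph s st.
rewrite in_itv /= => st E.
have -> : second_difference h u v t = ph t - ph 0.
  by rewrite /ph /second_difference !scale0r !add0r addrA; move: (h _) (h _) (h _) (h _) => *; ring.
rewrite E subr0 (deriveE _ dp).
have [_ e1] := Hr _ (small1 _ st); have [_ e2] := Hr _ (small2 _ st).
have [n1 n2] := small _ st.
have eL : 'd p x (s *: u + t *: v) = 'd p x (s *: u) + t * 'd p x v.
  by rewrite linearD [X in _ + X]linearZ.
rewrite {}eL in e2.
rewrite addrA; move: (p (s *: u + t *: v + x)) (p (s *: u + x)) e1 e2 => a b e1 e2.
move: (p x) ('d p x _) ('d p x v) e1 e2 => d l m e1 e2.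
have -> : (a - b) * t - t * t * m = t * ((a - d - (l + t * m)) - (b - d - l)) by ring.
rewrite normrM gtr0_norm //.
have -> : e * (t * t) * (2 * (`|u| + `|v|)) = t * (2 * (e * (t * N))) by rewrite /N; ring.
rewrite ler_pM2l //; apply: le_trans (ler_normB _ _) _.
apply: le_trans (lerD e2 e1) _; rewrite mulr2n mulrDl !mul1r.
apply: lerD; rewrite ler_pM2l //; apply: le_trans n1 _.
by rewrite ler_pM2l // lerDl.
Unshelve. all: by end_near. Qed.

(** The second difference is unchanged when [u] and [v] are exchanged, and divided by [t * t] it
    comes arbitrarily close to either mixed derivative. *)
Lemma derive_symmetric (h : V -> R) (u v : V) :
  (\forall y \near x, differentiable h y) ->
  differentiable ('D_u h) x -> differentiable ('D_v h) x ->
  'D_v ('D_u h) x = 'D_u ('D_v h) x.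
Proof.
move=> dh dp dq; apply/eqP; rewrite -subr_eq0 -normr_le0; apply/ler_addgt0Pr => e e0.
(* The summand 1 keeps [K] positive even for [u = v = 0]. Each of the two errors is at most
   [e / (2 * K) * (t * t) * (K - 1)], so their sum stays below [t * t * e]. *)
pose K := 2 * (`|u| + `|v|) + 1.
have K0 : 0 < K by rewrite /K; have := normr_ge0 u; have := normr_ge0 v; lra.
have e'0 : 0 < e / (2 * K) by rewrite divr_gt0 // mulr_gt0.
near (0:R)^'+ => t.
have t0 : 0 < t by near: t; exact: nbhs_right_gt.
have H1 : `|second_difference h u v t - t * t * 'D_v ('D_u h) x|
      <= e / (2 * K) * (t * t) * (2 * (`|u| + `|v|)).
  by near: t; exact: second_difference_approx.
have H2 : `|second_difference h v u t - t * t * 'D_u ('D_v h) x|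
      <= e / (2 * K) * (t * t) * (2 * (`|v| + `|u|)).
  by near: t; exact: second_difference_approx.
have E : second_difference h v u t = second_difference h u v t.
  by rewrite /second_difference [t *: v + t *: u]addrC; ring.
rewrite {}E [`|v| + _]addrC in H2.
have tt0 : 0 < t * t by rewrite mulr_gt0.
rewrite add0r; move: ('D_v ('D_u h) x) ('D_u ('D_v h) x) (second_difference h u v t) H1 H2.
move=> a b d H1 H2; rewrite -(ler_pM2l tt0) -{1}(gtr0_norm tt0) -normrM.
have -> : t * t * (a - b) = (d - t * t * b) - (d - t * t * a) by ring.
apply: (le_trans (ler_normB _ _)).
apply: (le_trans (lerD H2 H1)).
have -> : e / (2 * K) * (t * t) * (2 * (`|u| + `|v|)) + e / (2 * K) * (t * t) * (2 * (`|u| + `|v|))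
  = t * t * e * ((K - 1) / K).
  by rewrite /K; field; rewrite -/K gt_eqF.
rewrite -[leRHS]mulr1 ler_pM2l ?mulr_gt0 // ler_pdivrMr //; lra.
Unshelve. all: by end_near. Qed.

End Schwarz.

(** The difference [g - f] vanishes near [x], so its differential there is 0. This carries
    differentiability across identities that hold only on an open set, such as those for [invmx] and
    the Christoffel symbols. *)
Lemma near_eq_differentiable (R : realType) (V W : normedModType R)
    (f g : V -> W) x :
  (\forall y \near x, f y = g y) -> differentiable f x -> differentiable g x.
Proof.
move=> fg df; have -> : g = f + (g - f) by rewrite addrC subrK.
apply: differentiableD; first exact: df. set d := g - f.
have d0 : d x = 0 by rewrite /d -[LHS]/(g x - f x) (nbhs_singleton fg) subrr.
have dE : d \o shift x = cst (d x) + (\0 : {linear V -> W}) +o_ 0 id.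
  apply/eqaddoP => e e0; near=> k.
  have -> : (d \o shift x - (cst (d x) + (\0 : {linear V -> W}))) k = g (k + x) - f (k + x).
    by rewrite d0 /= /GRing.add /= /GRing.opp /= addr0 oppr0 addr0.
  suff -> : f (k + x) = g (k + x) by rewrite subrr normr0 mulr_ge0 // ltW.
  by near: k; move: fg; rewrite (near_shift 0) subr0.
have D0 : 'd d x = (\0 : {linear V -> W}) :> (V -> W).
  by apply: diff_unique => //; exact: cst_continuous.
apply/diff_locallyP; rewrite D0; split => //; exact: cst_continuous.
Unshelve. all: by end_near. Qed.

#[local] Opaque derive.

Lemma derive_symmetric_mx (R : realType) (V : normedModType R) (m n : nat)
    (F : V -> 'M[R]_(m, n)) x u v :
  (\forall y \near x, differentiable F y) ->
  differentiable ('D_u F) x -> differentiable ('D_v F) x ->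
  'D_v ('D_u F) x = 'D_u ('D_v F) x.
Proof.
move=> dF du dv; apply/matrixP => i j; 
have EE a b (da : differentiable ('D_a F) x) :
    ('D_b ('D_a F) x) i j = 'D_b (fun y => 'D_a F y i j) x.
  by apply/esym; exact: (@derive_entry _ _ _ _ ('D_a F) x b i j da).
apply: (etrans (EE u v du)); apply: (etrans _ (esym (EE v u dv))).
have E w : \forall y \near x, 'D_w F y i j = 'D_w (fun z => F z i j) y.
  by near=> y; rewrite derive_entry //; near: y.
have dE w : differentiable ('D_w F) x -> differentiable ('D_w (fun z => F z i j)) x.
  move=> dw; apply: near_eq_differentiable (E w) _; exact: differentiable_entry.
apply: (etrans (near_eq_derive _ (E u))); apply: (etrans _ (esym (near_eq_derive _ (E v)))).
apply: derive_symmetric; [|exact: dE|exact: dE].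
by near=> y; apply: differentiable_entry; near: y.
Unshelve. all: by end_near. Qed.

(** * Differentiation of bilinear forms, determinants and inverse matrices *)

Lemma bformE (R : realType) (n : nat) (A : 'M[R]_n) u v :
  bform A u v = \sum_i \sum_j u 0 i * A i j * v 0 j.
Proof.
rewrite /bform mxE exchange_big /=; apply: eq_bigr => j _.
by rewrite !mxE mulr_suml.
Qed.

Lemma bform_linearl (R : realType) (n : nat) (A : 'M[R]_n) v :
  linear_for *%R (bform A ^~ v).
Proof. by move=> a u w; rewrite /bform !mulmxDl -!scalemxAl !mxE. Qed.

Lemma bform_linearr (R : realType) (n : nat) (A : 'M[R]_n) v :
  linear_for *%R (bform A v).
Proof.
by move=> a u w; rewrite /bform linearP /= mulmxDr -scalemxAr !mxE.
Qed.

Section BformCalculus.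
Variables (R : realType) (V : normedModType R) (n : nat).
Variables (A : V -> 'M[R]_n) (b c : V -> 'rV[R]_n) (x : V).
Hypotheses (dA : differentiable A x) (db : differentiable b x)
  (dc : differentiable c x).

Let term i j : V -> R := (fun y => b y 0 i) * (fun y => A y i j) * (fun y => c y 0 j).

Let bform_sum : (fun y => bform (A y) (b y) (c y)) = \sum_i \sum_j term i j.
Proof.
apply/funext => y; rewrite bformE fct_sumE.
by apply: eq_bigr => i _; rewrite fct_sumE.
Qed.

Let term_diff i j : differentiable (term i j) x.
Proof.
apply: differentiableM; last exact: differentiable_entry.
by apply: differentiableM; exact: differentiable_entry.
Qed.

Lemma differentiable_bform : differentiable (fun y => bform (A y) (b y) (c y)) x.
Proof.
by rewrite bform_sum; apply: differentiable_sum => i; apply: differentiable_sum.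
Qed.

Lemma derive_bform u : 'D_u (fun y => bform (A y) (b y) (c y)) x =
  bform ('D_u A x) (b x) (c x) + bform (A x) ('D_u b x) (c x)
  + bform (A x) (b x) ('D_u c x).
Proof.
rewrite bform_sum derive_sum; last first.
  by move=> i; apply: diff_derivable; apply: differentiable_sum.
rewrite !bformE -!big_split /=; apply: eq_bigr => i _.
rewrite derive_sum; last by move=> j; exact: diff_derivable.
rewrite -!big_split /=; apply: eq_bigr => j _.
have d1 := diff_derivable (v := u) (differentiable_entry 0 i db).
have d2 := diff_derivable (v := u) (differentiable_entry i j dA).
have d3 := diff_derivable (v := u) (differentiable_entry 0 j dc).
apply: (etrans (deriveM (derivableM d1 d2) d3)); rewrite (deriveM d1 d2).
rewrite !derive_entry // ![_ *: _]mulrC.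
rewrite -[(_ * _) x]/(b x 0 i * A x i j).
by move: ('D_u _ _) ('D_u _ _) ('D_u _ _) => *; ring.
Qed.
End BformCalculus.

Lemma differentiable_prod (R : realType) (V : normedModType R) (I : Type) (r : seq I)
    (h : I -> V -> R) x :
  (forall i, differentiable (h i) x) -> differentiable (fun y => \prod_(i <- r) h i y) x.
Proof.
move=> dh; elim: r => [|i r IH].
  by under eq_fun do rewrite big_nil; exact: differentiable_cst.
under eq_fun do rewrite big_cons.
by apply: (@differentiableM _ _ (h i) _) => //.
Qed.

Lemma differentiable_bigsum (R : realType) (V W : normedModType R) (I : Type) (r : seq I)
    (h : I -> V -> W) x :
  (forall i, differentiable (h i) x) -> differentiable (fun y => \sum_(i <- r) h i y) x.
Proof.
move=> dh; elim: r => [|i r IH].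
  by under eq_fun do rewrite big_nil; exact: differentiable_cst.
under eq_fun do rewrite big_cons.
by apply: (@differentiableD _ _ _ (h i) _) => //.
Qed.

Lemma differentiable_det (R : realType) (V : normedModType R) (n : nat)
    (A : V -> 'M[R]_n) x :
  (forall i j, differentiable (fun y => A y i j) x) ->
  differentiable (fun y => \det (A y)) x.
Proof.
move=> dA; apply: differentiable_bigsum => s.
apply: (@differentiableM _ _ (cst _) _); first exact: differentiable_cst.
exact: differentiable_prod.
Qed.

(** Cramer's formula: adjugate over determinant, both polynomial in the entries. [invmx] has this
    form only at invertible matrices, hence the neighbourhood in the hypothesis. *)
Lemma differentiable_invmx (R : realType) (V : normedModType R) (n : nat)
    (A : V -> 'M[R]_n) x :
  (\forall y \near x, A y \in unitmx) -> differentiable A x ->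
  differentiable (fun y => invmx (A y)) x.
Proof.
move=> Au dA.
apply: (@near_eq_differentiable _ _ _ (fun y => (\det (A y))^-1 *: \adj (A y))).
  by near=> y; rewrite /invmx (_ : A y \in unitmx) //; near: y.
have dAij i j : differentiable (fun y => A y i j) x by exact: differentiable_entry.
apply: differentiable_mx => i j.
have -> : (fun y => ((\det (A y))^-1 *: \adj (A y)) i j) =
   (fun y => (\det (A y))^-1) * (fun y => cofactor (A y) j i).
  by apply/funext => y; rewrite !mxE.
apply: differentiableM.
  apply: differentiableV; first exact: differentiable_det.
  have := nbhs_singleton Au; rewrite unitmxE unitfE //.
apply: (@differentiableM _ _ (cst _) _); first exact: differentiable_cst.
apply: differentiable_det => k l.
by under eq_fun do rewrite !mxE.
Unshelve. all: by end_near. Qed.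

(** * Closure properties of smooth maps on an open set *)

Section Smooth.
Variables (R : realType) (n : nat) (W : normedModType R) (U : set 'rV[R]_n).
Hypothesis oU : open U.
Implicit Types h k : 'rV[R]_n -> W.

Lemma iter_partial_eq h k s :
  (forall x, U x -> h x = k x) -> forall x, U x -> iter_partial s h x = iter_partial s k x.
Proof.
move=> hk; elim: s => [|i s IH] x Ux /=; first exact: hk.
apply: near_eq_derive.
by near=> y; apply: IH; near: y; exact: open_nbhs_nbhs.
Unshelve. all: by end_near. Qed.

Lemma smooth_on_eq h k : (forall x, U x -> h x = k x) -> smooth_on U h -> smooth_on U k.
Proof.
move=> hk sh s x Ux; apply: near_eq_differentiable (sh s x Ux).
by near=> y; apply: iter_partial_eq => //; near: y; exact: open_nbhs_nbhs.
Unshelve. all: by end_near. Qed.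

Lemma smooth_on_differentiable h x : smooth_on U h -> U x -> differentiable h x.
Proof. by move=> sh Ux; exact: (sh [::]). Qed.

Lemma iter_partial_lincomb (a : R) h k s : smooth_on U h -> smooth_on U k ->
  forall x, U x -> iter_partial s (a *: h + k) x = a *: iter_partial s h x + iter_partial s k x.
Proof.
move=> sh sk; elim: s => [|i s IH] x Ux //=.
rewrite (@near_eq_derive _ _ _ _ (a *: iter_partial s h + iter_partial s k)); last first.
  by near=> y; apply: IH; near: y; exact: open_nbhs_nbhs.
have dh := diff_derivable (v := delta_mx 0 i) (sh s x Ux).
have dk := diff_derivable (v := delta_mx 0 i) (sk s x Ux).
by rewrite deriveD ?deriveZ //; exact: derivableZ.
Unshelve. all: by end_near. Qed.

Lemma smooth_on_lincomb (a : R) h k : smooth_on U h -> smooth_on U k ->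
  smooth_on U (a *: h + k).
Proof.
move=> sh sk s x Ux.
apply: (@near_eq_differentiable _ _ _ (a *: iter_partial s h + iter_partial s k)).
  by near=> y; apply/esym/iter_partial_lincomb => //; near: y; exact: open_nbhs_nbhs.
apply: differentiableD; last exact: sk.
by apply: differentiableZ; exact: sh.
Unshelve. all: by end_near. Qed.

Lemma smooth_on_partial h i : smooth_on U h -> smooth_on U ('D_(delta_mx 0 i) h).
Proof.
move=> sh s x Ux; have := sh (rcons s i) x Ux.
by rewrite /iter_partial -cats1 foldr_cat.
Qed.

Lemma smooth_on_cst (a : W) : smooth_on U (fun=> a).
Proof.
suff E s : iter_partial s (fun=> a : W) = cst (if s is [::] then a else 0) :> ('rV[R]_n -> W).
  by move=> s x Ux; rewrite E; exact: differentiable_cst.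
by elim: s => [//|i s /= ->]; apply/funext => x /=; rewrite derive_cst.
Qed.

(** [smooth_on] speaks of coordinate directions only. An arbitrary constant direction is reached
    because on [U], where [h] is differentiable, its derivative is a combination of the partial
    ones. *)
Lemma smooth_on_derive h v : smooth_on U h -> smooth_on U ('D_v h).
Proof.
move=> sh; pose D (r : seq 'I_n) (y : 'rV[R]_n) :=
  \sum_(i <- r) v 0 i *: 'D_(delta_mx 0 i) h y.
apply: (@smooth_on_eq (D (index_enum 'I_n))) => [x Ux|].
  have dh := smooth_on_differentiable sh Ux.
  rewrite [in RHS](row_sum_delta v) (deriveE _ dh) linear_sum; apply: eq_bigr => i _.
  by rewrite linearZ (deriveE _ dh).
elim: (index_enum _) => [|i r IH].
  by rewrite /D; under eq_fun do rewrite big_nil; exact: smooth_on_cst.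
apply: (@smooth_on_eq (v 0 i *: 'D_(delta_mx 0 i) h + D r)) => [x Ux|].
  by rewrite /D big_cons.
by apply: smooth_on_lincomb => //; exact: smooth_on_partial.
Qed.
End Smooth.

(** * Christoffel symbols and covariant derivatives along a map *)

Lemma differentiable_mulmx (R : realType) (V : normedModType R) (m n p : nat)
    (A : V -> 'M[R]_(m, n)) (B : V -> 'M[R]_(n, p)) x :
  differentiable A x -> differentiable B x -> differentiable (fun y => A y *m B y) x.
Proof.
move=> dA dB; apply: differentiable_mx => i j.
under eq_fun do rewrite mxE.
apply: differentiable_bigsum => k.
by apply: (@differentiableM _ _ (fun y => A y i k) (fun y => B y k j));
  exact: differentiable_entry.
Qed.

Lemma derive_bform_cst (R : realType) (V : normedModType R) (n : nat)
    (A : V -> 'M[R]_n) x u v w : differentiable A x ->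
  'D_u (fun y => bform (A y) v w) x = bform ('D_u A x) v w.
Proof.
move=> dA; rewrite (derive_bform (b := cst v) (c := cst w) dA) //.
by rewrite !derive_cst /bform !(mulmx0, mul0mx, trmx0) !mxE !addr0.
Qed.

Lemma sharp_linear (R : realType) (n : nat) (A : 'M[R]_n) (a : R) (f h : 'rV[R]_n -> R) :
  sharp A (fun w => a * f w + h w) = a *: sharp A f + sharp A h.
Proof.
rewrite /sharp scalemxAl -mulmxDl; congr (_ *m _).
by apply/rowP => i; rewrite !mxE.
Qed.

Lemma bform_linearmx (R : realType) (n : nat) (a : R) (A B : 'M[R]_n) u v :
  bform (a *: A + B) u v = a * bform A u v + bform B u v.
Proof. by rewrite /bform mulmxDr mulmxDl -scalemxAr -scalemxAl !mxE. Qed.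

Lemma bform_eq0 (R : realType) (n : nat) (A : 'M[R]_n) u :
  A \in unitmx -> (forall v, bform A u v = 0) -> u = 0.
Proof.
move=> Au uv; rewrite -[u](mulmxK Au); suff -> : u *m A = 0 by rewrite mul0mx.
apply/rowP => i; rewrite [RHS]mxE -(uv (delta_mx 0 i)) /bform trmx_delta -colE.
by rewrite [RHS]mxE.
Qed.

(* [a] is a vector field along the map [F], and [g] the metric on the target. *)
Definition cov (R : realType) (k m : nat) (g : 'rV[R]_m -> 'M[R]_m)
    (F a : 'rV[R]_k -> 'rV[R]_m) (u x : 'rV[R]_k) : 'rV[R]_m :=
  'D_u a x + christoffel g (F x) ('D_u F x) (a x).

(** This is [A v w] of the overview: the ambient derivative of dF(w) along v, tangential part
    included. *)
Definition hess (R : realType) (k m : nat) (g : 'rV[R]_m -> 'M[R]_m)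
    (F : 'rV[R]_k -> 'rV[R]_m) (v w : 'rV[R]_k) : 'rV[R]_k -> 'rV[R]_m :=
  cov g F ('D_w F) v.

(** What a Gram matrix satisfies on an open part of a coordinate domain. The local theory starts
    from this alone and serves the ambient and the induced metric alike. *)
Definition local_metric (R : realType) (m : nat) (U : set 'rV[R]_m)
    (g : 'rV[R]_m -> 'M[R]_m) : Prop :=
  [/\ open U, smooth_on U g, forall y, U y -> (g y)^T = g y
    & forall y, U y -> g y \in unitmx].

Section LocalMetric.
Variables (R : realType) (m : nat) (U : set 'rV[R]_m) (g : 'rV[R]_m -> 'M[R]_m).
Hypothesis Ug : local_metric U g.

Let oU : open U. Proof. by case: Ug. Qed.
Let sg : smooth_on U g. Proof. by case: Ug. Qed.
Let gT y : U y -> (g y)^T = g y. Proof. by case: Ug => ? ? h ?; exact: h. Qed.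
Let gu y : U y -> g y \in unitmx. Proof. by case: Ug => ? ? ?; exact. Qed.

Lemma metric_differentiable q : U q -> differentiable g q.
Proof. exact: smooth_on_differentiable. Qed.
Let dg := metric_differentiable.

Lemma metric_near_sym q : U q -> \forall y \near q, (g y)^T = g y.
Proof.
by move=> Uq; near=> y; apply: gT; near: y; exact: open_nbhs_nbhs.
Unshelve. all: by end_near. Qed.

Lemma christoffelE q u v : U q ->
  christoffel g q u v = sharp (g q) (fun w => 2^-1 *
    (bform ('D_u g q) v w + bform ('D_v g q) u w - bform ('D_w g q) u v)).
Proof.
move=> Uq; rewrite /christoffel; congr sharp; apply/funext => w.
by rewrite !derive_bform_cst //; exact: dg.
Qed.

Lemma christoffel_sym q u v : U q -> christoffel g q u v = christoffel g q v u.
Proof.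
by move=> Uq; apply: christoffelC; [exact: metric_near_sym | exact: dg].
Qed.

Lemma christoffel_linearl q v : U q -> linear (christoffel g q ^~ v).
Proof.
move=> Uq a u w; rewrite !christoffelE // -sharp_linear; congr sharp.
apply/funext => z; rewrite (derive_linear (dg Uq)).
move: ('D_u g q) ('D_v g q) ('D_w g q) ('D_z g q) => A B C D.
rewrite bform_linearmx (bform_linearl B) (bform_linearl D).
move: (bform A v z) (bform B u z) (bform C v z) (bform D u v) (bform B w z) (bform D w v) => *.
ring.
Qed.

Lemma christoffel_linearr q u : U q -> linear (christoffel g q u).
Proof.
by move=> Uq a v w; rewrite !(christoffel_sym u) // christoffel_linearl.
Qed.

Lemma christoffel0l q v : U q -> christoffel g q 0 v = 0.
Proof.
move=> Uq; have := christoffel_linearl v Uq (-1) 0 0.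
by rewrite scaler0 addr0 scaleN1r addNr.
Qed.

Lemma differentiable_christoffel q u v : U q -> differentiable (fun y => christoffel g y u v) q.
Proof.
move=> Uq.
have nU : \forall y \near q, U y by exact: open_nbhs_nbhs.
apply: (@near_eq_differentiable _ _ _ (fun y => sharp (g y) (fun w => 2^-1 *
    (bform ('D_u g y) v w + bform ('D_v g y) u w - bform ('D_w g y) u v)))).
  by near=> y; rewrite christoffelE //; near: y.
have dDg w : differentiable ('D_w g) q.
  by apply: (smooth_on_differentiable _ Uq); exact: smooth_on_derive.
have dB a b c : differentiable (fun y => bform ('D_a g y) b c) q.
  by apply: (@differentiable_bform _ _ _ _ (cst b) (cst c)).
apply: differentiable_mulmx.
  apply: differentiable_mx => i j; under eq_fun do rewrite mxE.
  apply: (@differentiableZ _ _ _ (fun y => (bform ('D_u g y) v (delta_mx 0 j) +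
     bform ('D_v g y) u (delta_mx 0 j) - bform ('D_(delta_mx 0 j) g y) u v))).
  apply: (@differentiableB _ _ _ (fun y => bform ('D_u g y) v (delta_mx 0 j) +
     bform ('D_v g y) u (delta_mx 0 j)) (fun y => bform ('D_(delta_mx 0 j) g y) u v)) => //.
  exact: (@differentiableD _ _ _ (fun y => bform ('D_u g y) v (delta_mx 0 j))
     (fun y => bform ('D_v g y) u (delta_mx 0 j))).
apply: differentiable_invmx; last exact: dg.
by near=> y; apply: gu; near: y.
Unshelve. all: by end_near. Qed.

(** Component [k] of the Christoffel symbols as a matrix: on [U] it turns [christoffel] into a
    [bform], to which the rules for bilinear forms apply. *)
Let chr_mx (k : 'I_m) (q : 'rV[R]_m) : 'M[R]_m :=
  \matrix_(i, j) christoffel g q (delta_mx 0 i) (delta_mx 0 j) 0 k.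

Let christoffel_bform q b c k : U q -> christoffel g q b c 0 k = bform (chr_mx k q) b c.
Proof.
move=> Uq.
pose l1 v : {linear 'rV[R]_m -> 'rV[R]_m} :=
  HB.pack (christoffel g q ^~ v) (GRing.isLinear.Build R _ _ _ _ (christoffel_linearl v Uq)).
pose l2 u : {linear 'rV[R]_m -> 'rV[R]_m} :=
  HB.pack (christoffel g q u) (GRing.isLinear.Build R _ _ _ _ (christoffel_linearr u Uq)).
rewrite bformE {1}(row_sum_delta b) -[christoffel _ _ _ _]/(l1 c _) linear_sum summxE.
apply: eq_bigr => i _; rewrite linearZ mxE /=.
rewrite {1}(row_sum_delta c) -[christoffel _ _ _ _]/(l2 _ _) linear_sum summxE mulr_sumr.
by apply: eq_bigr => j _; rewrite linearZ !mxE /= mulrA mulrAC.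
Qed.

Let differentiable_chr_mx k q : U q -> differentiable (chr_mx k) q.
Proof.
move=> Uq; apply: differentiable_mx => i j; under eq_fun do rewrite mxE.
by apply: differentiable_entry; exact: differentiable_christoffel.
Qed.

Section Along.
Variables (V : normedModType R) (F : V -> 'rV[R]_m) (x : V).
Hypotheses (dF : differentiable F x) (UF : U (F x)).

Lemma along_near : \forall y \near x, U (F y).
Proof.
have cF : {for x, continuous F} by exact: differentiable_continuous.
by apply: cF; exact: open_nbhs_nbhs.
Qed.

Variables (b c : V -> 'rV[R]_m).
Hypotheses (db : differentiable b x) (dc : differentiable c x).

Let near_bform k : \forall y \near x,
  bform (chr_mx k (F y)) (b y) (c y) = christoffel g (F y) (b y) (c y) 0 k.
Proof.
near=> y; rewrite christoffel_bform //; near: y; exact: along_near.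
Unshelve. all: by end_near. Qed.

Let dKF k : differentiable (chr_mx k \o F) x.
Proof. by apply: differentiable_comp => //; exact: differentiable_chr_mx. Qed.

Lemma differentiable_christoffel_along :
  differentiable (fun y => christoffel g (F y) (b y) (c y)) x.
Proof.
apply: differentiable_mx => i k; rewrite (ord1 i).
by apply: near_eq_differentiable (near_bform k) _; exact: (differentiable_bform (dKF k)).
Qed.

(** Product and chain rule; the first term differentiates the coefficients with both arguments
    frozen at [x]. *)
Lemma derive_christoffel_along u :
  'D_u (fun y => christoffel g (F y) (b y) (c y)) x =
  'D_('D_u F x) (fun q => christoffel g q (b x) (c x)) (F x)
  + christoffel g (F x) ('D_u b x) (c x) + christoffel g (F x) (b x) ('D_u c x).
Proof.
apply/rowP => k; rewrite [RHS]mxE [X in _ = X + _]mxE.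
apply: (etrans (esym (derive_entry u 0 k differentiable_christoffel_along))).
apply: (etrans (esym (near_eq_derive u (near_bform k)))).
apply: (etrans (derive_bform (dKF k) db dc u)).
rewrite -!(christoffel_bform _ _ _ UF); congr (_ + _ + _).
rewrite (derive_comp u dF (differentiable_chr_mx k UF)).
rewrite -(derive_bform_cst _ _ _ (differentiable_chr_mx k UF)).
rewrite -derive_entry; last exact: differentiable_christoffel.
apply: near_eq_derive; near=> q; rewrite christoffel_bform //.
by near: q; exact: open_nbhs_nbhs.
Unshelve. all: by end_near. Qed.
End Along.
End LocalMetric.

#[local] Opaque christoffel.

Lemma bformDl (R : realType) (n : nat) (A : 'M[R]_n) u v w :
  bform A (u + v) w = bform A u w + bform A v w.
Proof. by have := bform_linearl A w 1 u v; rewrite scale1r mul1r. Qed.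

Lemma bformDr (R : realType) (n : nat) (A : 'M[R]_n) u v w :
  bform A u (v + w) = bform A u v + bform A u w.
Proof. by have := bform_linearr A u 1 v w; rewrite scale1r mul1r. Qed.

Lemma bformBl (R : realType) (n : nat) (A : 'M[R]_n) u v w :
  bform A (u - v) w = bform A u w - bform A v w.
Proof.
by have := bform_linearl A w (-1) v u; rewrite scaleN1r mulN1r [- v + u]addrC => ->; rewrite addrC.
Qed.

(** * Metric compatibility and curvature along a map *)

Section MetricAlongMaps.
Variables (R : realType) (m : nat) (U : set 'rV[R]_m) (g : 'rV[R]_m -> 'M[R]_m).
Hypothesis Ug : local_metric U g.

Let gu y : U y -> g y \in unitmx. Proof. by case: Ug => ? ? ?; exact. Qed.

Lemma derive_metric_along (V : normedModType R) (F a b : V -> 'rV[R]_m) x u :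
  differentiable F x -> differentiable a x -> differentiable b x -> U (F x) ->
  'D_u (fun y => bform (g (F y)) (a y) (b y)) x
  = bform (g (F x)) ('D_u a x + christoffel g (F x) ('D_u F x) (a x)) (b x)
    + bform (g (F x)) (a x) ('D_u b x + christoffel g (F x) ('D_u F x) (b x)).
Proof.
move=> dF da db UF.
have dg := metric_differentiable Ug UF.
apply: (etrans (derive_bform (differentiable_comp dF dg) da db u)).
rewrite (derive_comp u dF dg) -(derive_bform_cst _ _ _ dg) bformDl bformDr.
rewrite (christoffel_metric (metric_near_sym Ug UF) (gu UF) dg).
move: (bform _ _ _) (bform _ _ _) (bform _ _ _) (bform _ _ _) => ? ? ? ?.
ring.
Qed.

(** Constant fields have vanishing bracket, and the covariant derivative of one along another is the
    Christoffel term alone. *)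
Lemma curvatureE q a b c : U q -> curvature g q a b c =
  ('D_a (fun y => christoffel g y b c) q + christoffel g q a (christoffel g q b c))
  - ('D_b (fun y => christoffel g y a c) q + christoffel g q b (christoffel g q a c)).
Proof.
move=> Uq; rewrite /curvature /curvature_field.
have nE v w : nabla g (cst v) (cst w) = fun y => christoffel g y v w.
  by apply/funext => y; rewrite /nabla derive_cst add0r.
have lb : lie_bracket (cst a) (cst b) q = 0.
  by rewrite /lie_bracket !derive_cst subrr.
have n3 : nabla g (lie_bracket (cst a) (cst b)) (cst c) q = 0.
  by rewrite /nabla lb derive_cst add0r (christoffel0l Ug _ Uq).
rewrite n3.
rewrite subr0.
rewrite !nE.
reflexivity.
Qed.

(** Metric compatibility for constant fields: g(nabla_u nabla_v w, z) = D_u g(nabla_v w, z) -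
    g(nabla_v w, nabla_u z). Only scalar functions are differentiated, which is the shape that the
    symmetries and the Gauss equation start from. *)
Lemma riem_derive x u v w z : U x -> riem g x u v w z =
  ('D_u (fun y => bform (g y) (christoffel g y v w) z) x
    - bform (g x) (christoffel g x v w) (christoffel g x u z))
  - ('D_v (fun y => bform (g y) (christoffel g y u w) z) x
    - bform (g x) (christoffel g x u w) (christoffel g x v z)).
Proof.
move=> Ux.
have E a b : bform (g x) ('D_a (fun y => christoffel g y b w) x
                 + christoffel g x a (christoffel g x b w)) z =
    'D_a (fun y => bform (g y) (christoffel g y b w) z) x
    - bform (g x) (christoffel g x b w) (christoffel g x a z).
  have dc := differentiable_christoffel Ug b w Ux.
  have did : differentiable (id : 'rV[R]_m -> 'rV[R]_m) x by [].
  have dz : differentiable (cst z : 'rV[R]_m -> 'rV[R]_m) x by [].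
  apply/eqP; rewrite eq_sym subr_eq; apply/eqP.
  apply: (etrans (derive_metric_along a did dc dz Ux)).
  by rewrite derive_id derive_cst add0r.
rewrite /riem (curvatureE _ _ _ Ux) bformBl.
exact: (f_equal2 (fun s t : R => s - t) (E u v) (E v u)).
Qed.

Section Map.
Variables (k : nat) (D : set 'rV[R]_k) (F : 'rV[R]_k -> 'rV[R]_m).
Hypotheses (oD : open D) (sF : smooth_on D F) (FD : forall y, D y -> U (F y)).

Let dF y : D y -> differentiable F y.
Proof. exact: smooth_on_differentiable. Qed.
Let dDF w y : D y -> differentiable ('D_w F) y.
Proof. by apply: smooth_on_differentiable; exact: smooth_on_derive. Qed.
Let dDDF v w y : D y -> differentiable ('D_v ('D_w F)) y.
Proof.
by apply: smooth_on_differentiable; do 2!apply: smooth_on_derive => //.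
Qed.

Lemma smooth_derive_sym u v y : D y -> 'D_u ('D_v F) y = 'D_v ('D_u F) y.
Proof.
move=> Dy; apply: derive_symmetric_mx; [|exact: dDF|exact: dDF].
by near=> z; apply: dF; near: z; exact: open_nbhs_nbhs.
Unshelve. all: by end_near. Qed.

Lemma smooth_derive3_sym u v w y : D y ->
  'D_u ('D_v ('D_w F)) y = 'D_v ('D_u ('D_w F)) y.
Proof.
move=> Dy; apply: derive_symmetric_mx; [|exact: dDDF|exact: dDDF].
by near=> z; apply: dDF; near: z; exact: open_nbhs_nbhs.
Unshelve. all: by end_near. Qed.

Lemma hess_sym v w y : D y -> hess g F v w y = hess g F w v y.
Proof.
move=> Dy; rewrite /hess /cov (christoffel_sym Ug _ _ (FD Dy)).
exact: (f_equal2 +%R (smooth_derive_sym v w Dy) erefl).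
Qed.

Lemma differentiable_hess v w y : D y -> differentiable (hess g F v w) y.
Proof.
move=> Dy; apply: (@differentiableD _ _ _ ('D_v ('D_w F))
  (fun y => christoffel g (F y) ('D_v F y) ('D_w F y))); first exact: dDDF.
apply: (differentiable_christoffel_along Ug (dF Dy) (FD Dy)); exact: dDF.
Qed.

(** Two covariant derivatives of the field dF(w) are commuted. The third derivatives of F and the
    terms in D_u D_v F cancel by symmetry; the terms in a first derivative of dF(w) cancel between
    the product rule on one side and the outer connection term on the other. *)
Lemma curvature_along u v w x : D x ->
  cov g F (hess g F v w) u x - cov g F (hess g F u w) v x
  = curvature g (F x) ('D_u F x) ('D_v F x) ('D_w F x).
Proof.
move=> Dx; have UF := FD Dx.
have E a b : cov g F (hess g F b w) a x = 'D_a ('D_b ('D_w F)) x +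
    ('D_('D_a F x) (fun q => christoffel g q ('D_b F x) ('D_w F x)) (F x)
    + christoffel g (F x) ('D_a ('D_b F) x) ('D_w F x)
    + christoffel g (F x) ('D_b F x) ('D_a ('D_w F) x))
    + (christoffel g (F x) ('D_a F x) ('D_b ('D_w F) x)
    + christoffel g (F x) ('D_a F x) (christoffel g (F x) ('D_b F x) ('D_w F x))).
  have dd := differentiable_christoffel_along Ug (dF Dx) UF (dDF b Dx) (dDF w Dx).
  apply: (f_equal2 +%R).
    apply: (etrans (deriveD (diff_derivable (v := a) (dDDF b w Dx))
     (diff_derivable (v := a) dd))).
    apply: (f_equal2 +%R erefl).
    exact: (derive_christoffel_along Ug (dF Dx) UF (dDF b Dx) (dDF w Dx) a).
  have := christoffel_linearr Ug ('D_a F x) UF 1 ('D_b ('D_w F) x)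
     (christoffel g (F x) ('D_b F x) ('D_w F x)).
  by rewrite !scale1r.
apply: (etrans (f_equal2 (fun s t => s - t) (E u v) (E v u))).
rewrite (curvatureE _ _ _ UF).
have e1 := smooth_derive3_sym u v w Dx.
have e2 := smooth_derive_sym u v Dx.
clear E; generalize dependent ('D_u ('D_v ('D_w F)) x) => d1.
generalize ('D_v ('D_u ('D_w F)) x) => d2 ->.
generalize dependent ('D_u ('D_v F) x) => d3.
generalize ('D_v ('D_u F) x) => d4 ->.
generalize (christoffel g (F x) d4 ('D_w F x)) => c1.
generalize (christoffel g (F x) ('D_v F x) ('D_u ('D_w F) x)) => c2.
generalize (christoffel g (F x) ('D_u F x) ('D_v ('D_w F) x)) => c3.
generalize (christoffel g (F x) ('D_u F x)
  (christoffel g (F x) ('D_v F x) ('D_w F x))) => c4.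
generalize (christoffel g (F x) ('D_v F x)
  (christoffel g (F x) ('D_u F x) ('D_w F x))) => c5.
generalize ('D_('D_u F x) (fun q => christoffel g q ('D_v F x) ('D_w F x)) (F x)) => c6.
generalize ('D_('D_v F x) (fun q => christoffel g q ('D_u F x) ('D_w F x)) (F x)) => c7.
by apply/rowP => i; rewrite !mxE; ring.
Qed.
End Map.
End MetricAlongMaps.

(** * Symmetries of the curvature tensor and the Gauss equation *)

Section RiemannSymmetries.
Variables (R : realType) (m : nat) (U : set 'rV[R]_m) (g : 'rV[R]_m -> 'M[R]_m).
Hypothesis Ug : local_metric U g.

Let oU : open U. Proof. by case: Ug. Qed.
Let sg : smooth_on U g. Proof. by case: Ug. Qed.
Let gT y : U y -> (g y)^T = g y. Proof. by case: Ug => ? ? h ?; exact: h. Qed.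
Let gu y : U y -> g y \in unitmx. Proof. by case: Ug => ? ? ?; exact. Qed.
Let dg y : U y -> differentiable g y. Proof. exact: metric_differentiable. Qed.

Lemma riem_antisym12 x u v w z : U x -> riem g x u v w z = - riem g x v u w z.
Proof.
by move=> Ux; rewrite (riem_derive Ug u v w z Ux) (riem_derive Ug v u w z Ux) [RHS]opprB.
Qed.

(** In the sum of the two [riem_derive] formulas the terms without outer derivative cancel. By
    metric compatibility the others add up to D_u D_v g(w, z) - D_v D_u g(w, z), which is 0. *)
Lemma riem_antisym34 x u v w z : U x -> riem g x u v w z = - riem g x u v z w.
Proof.
move=> Ux; apply/eqP; rewrite -addr_eq0; apply/eqP.
rewrite (riem_derive Ug u v w z Ux) (riem_derive Ug u v z w Ux).
have dG a b c y : U y -> differentiable (fun y => bform (g y) (christoffel g y a b) c) y.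
  move=> Uy; apply: (@differentiable_bform _ _ _ g (fun y => christoffel g y a b) (cst c)) => //.
    exact: dg.
  exact: (differentiable_christoffel Ug).
have E a b : 'D_a (fun y => bform (g y) (christoffel g y b w) z) x
    + 'D_a (fun y => bform (g y) (christoffel g y b z) w) x
    = bform ('D_a ('D_b g) x) w z.
  have T := deriveD (diff_derivable (v := a) (dG b w z x Ux))
     (diff_derivable (v := a) (dG b z w x Ux)).
  apply: (etrans (esym T)) => {T}.
  apply: (etrans (near_eq_derive (g := fun y => bform ('D_b g y) w z) a _)).
    near=> y; have Uy : U y by near: y; exact: open_nbhs_nbhs.
    rewrite -(derive_bform_cst b w z (dg Uy)).
    rewrite (christoffel_metric (metric_near_sym Ug Uy) (gu Uy) (dg Uy)).
    by rewrite -[LHS]/(_ + _) (bform_sym w _ (gT Uy)).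
  apply: derive_bform_cst.
  by apply: (smooth_on_differentiable _ Ux); exact: smooth_on_derive.
have S : 'D_u ('D_v g) x = 'D_v ('D_u g) x.
  have dDg a : differentiable ('D_a g) x.
    by apply: (smooth_on_differentiable _ Ux); exact: smooth_on_derive.
  apply: derive_symmetric_mx; [|exact: dDg|exact: dDg].
  by near=> y; apply: dg; near: y; exact: open_nbhs_nbhs.
have Euv := E u v; have Evu := E v u.
have eS := f_equal (fun A => bform A w z) S.
have {eS Euv Evu} := etrans Euv (etrans eS (esym Evu)).
have := bform_sym (christoffel g x v z) (christoffel g x u w) (gT Ux).
have := bform_sym (christoffel g x u z) (christoffel g x v w) (gT Ux).
generalize ('D_u (fun y => bform (g y) (christoffel g y v w) z) x) => d1.
generalize ('D_u (fun y => bform (g y) (christoffel g y v z) w) x) => d2.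
generalize ('D_v (fun y => bform (g y) (christoffel g y u w) z) x) => d3.
generalize ('D_v (fun y => bform (g y) (christoffel g y u z) w) x) => d4.
generalize (bform (g x) (christoffel g x v w) (christoffel g x u z)) => b1.
generalize (bform (g x) (christoffel g x u w) (christoffel g x v z)) => b2.
generalize (bform (g x) (christoffel g x u z) (christoffel g x v w)) => b3.
generalize (bform (g x) (christoffel g x v z) (christoffel g x u w)) => b4 -> -> e.
have -> : d1 = d3 + d4 - d2 by rewrite -e; ring.
ring.
Unshelve. all: by end_near. Qed.

(** The cyclic sum of [riem_derive] cancels in pairs because the Christoffel symbols are
    symmetric. *)
Lemma riem_bianchi x u v w z : U x ->
  riem g x u v w z + riem g x v w u z + riem g x w u v z = 0.
Proof.
move=> Ux; rewrite (riem_derive Ug u v w z Ux) (riem_derive Ug v w u z Ux) (riem_derive Ug w u v z Ux).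
have E a b c : 'D_a (fun y => bform (g y) (christoffel g y b c) z) x
    = 'D_a (fun y => bform (g y) (christoffel g y c b) z) x.
  apply: near_eq_derive; near=> y; rewrite (christoffel_sym Ug) //.
  by near: y; exact: open_nbhs_nbhs.
have := E u v w; have := E v w u; have := E w u v => {E}.
rewrite (christoffel_sym Ug w v Ux) (christoffel_sym Ug w u Ux) (christoffel_sym Ug v u Ux).
generalize ('D_u (fun y => bform (g y) (christoffel g y v w) z) x) => d1.
generalize ('D_u (fun y => bform (g y) (christoffel g y w v) z) x) => d2.
generalize ('D_v (fun y => bform (g y) (christoffel g y u w) z) x) => d3.
generalize ('D_v (fun y => bform (g y) (christoffel g y w u) z) x) => d4.
generalize ('D_w (fun y => bform (g y) (christoffel g y u v) z) x) => d5.
generalize ('D_w (fun y => bform (g y) (christoffel g y v u) z) x) => d6 -> -> ->.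
generalize (bform (g x) (christoffel g x v w) (christoffel g x u z)) => b1.
generalize (bform (g x) (christoffel g x u w) (christoffel g x v z)) => b2.
generalize (bform (g x) (christoffel g x u v) (christoffel g x w z)) => b3.
ring.
Unshelve. all: by end_near. Qed.
End RiemannSymmetries.

Section Gauss.
Variables (R : realType) (m k : nat).
Variables (U : set 'rV[R]_m) (g : 'rV[R]_m -> 'M[R]_m).
Variables (D : set 'rV[R]_k) (h : 'rV[R]_k -> 'M[R]_k) (F : 'rV[R]_k -> 'rV[R]_m).
Hypotheses (Ug : local_metric U g) (Dh : local_metric D h).
Hypotheses (sF : smooth_on D F) (FD : forall y, D y -> U (F y)).
Hypothesis pull : forall y, D y -> forall v w,
  bform (h y) v w = bform (g (F y)) ('D_v F y) ('D_w F y).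

Let oD : open D. Proof. by case: Dh. Qed.
Let gT y : U y -> (g y)^T = g y. Proof. by case: Ug => ? ? e ?; exact: e. Qed.
Let hu y : D y -> h y \in unitmx. Proof. by case: Dh => ? ? ?; exact. Qed.
Let dF y : D y -> differentiable F y.
Proof. exact: smooth_on_differentiable. Qed.
Let dDF w y : D y -> differentiable ('D_w F) y.
Proof. by apply: smooth_on_differentiable; exact: smooth_on_derive. Qed.

Let derive_pull a b c y : D y -> 'D_a (fun y => bform (h y) b c) y =
  bform (g (F y)) (hess g F a b y) ('D_c F y) + bform (g (F y)) (hess g F a c y) ('D_b F y).
Proof.
move=> Dy; apply: (etrans (near_eq_derive
   (g := fun y => bform (g (F y)) ('D_b F y) ('D_c F y)) a _)).
  by near=> z; apply: pull; near: z; exact: open_nbhs_nbhs.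
apply: (etrans (derive_metric_along Ug a (dF Dy) (dDF b Dy) (dDF c Dy) (FD Dy))).
by apply: (f_equal2 +%R erefl); rewrite (bform_sym _ _ (gT (FD Dy))).
Unshelve. all: by end_near. Qed.

(** Differentiating [pull] expresses the derivatives of [h] by [hess], and symmetry of [hess]
    collapses the Koszul formula to one term. Geometrically, the induced connection is the
    tangential part of the ambient one. *)
Lemma pull_christoffel y v w z : D y ->
  bform (h y) (christoffel h y v w) z = bform (g (F y)) (hess g F v w y) ('D_z F y).
Proof.
move=> Dy; rewrite (bform_christoffel (hu Dy) (metric_differentiable Dh Dy)).
rewrite (derive_pull v w z Dy) (derive_pull w v z Dy) (derive_pull z v w Dy).
rewrite (hess_sym Ug oD sF FD w v Dy) (hess_sym Ug oD sF FD z v Dy) (hess_sym Ug oD sF FD z w Dy).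
generalize (bform (g (F y)) (hess g F v w y) ('D_z F y)) => b1.
generalize (bform (g (F y)) (hess g F v z y) ('D_w F y)) => b2.
generalize (bform (g (F y)) (hess g F w z y) ('D_v F y)) => b3.
by field.
Qed.

(** The differentiated form of [pull_christoffel] links the two curvatures. Each bracket is an inner
    product of two values of [hess] minus that of their tangential parts, hence the product of the
    normal parts, expressed without a normal vector. *)
Lemma gauss_equation x u v w z : D x ->
  riem h x u v w z = riem g (F x) ('D_u F x) ('D_v F x) ('D_w F x) ('D_z F x)
  + (bform (g (F x)) (hess g F v w x) (hess g F u z x)
     - bform (h x) (christoffel h x v w) (christoffel h x u z))
  - (bform (g (F x)) (hess g F u w x) (hess g F v z x)
     - bform (h x) (christoffel h x u w) (christoffel h x v z)).
Proof.
move=> Dx; rewrite (riem_derive Dh _ _ _ _ Dx).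
have E a b : 'D_a (fun y => bform (h y) (christoffel h y b w) z) x =
    bform (g (F x)) (cov g F (hess g F b w) a x) ('D_z F x)
    + bform (g (F x)) (hess g F b w x) (hess g F a z x).
  apply: (etrans (near_eq_derive
     (g := fun y => bform (g (F y)) (hess g F b w y) ('D_z F y)) a _)).
    by near=> y; apply: pull_christoffel; near: y; exact: open_nbhs_nbhs.
  exact: (derive_metric_along Ug a (dF Dx) (differentiable_hess Ug oD sF FD b w Dx)
     (dDF z Dx) (FD Dx)).
rewrite /riem -(curvature_along Ug oD sF FD u v w Dx) bformBl.
have := E u v; have := E v u => {E}.
generalize ('D_u (fun y => bform (h y) (christoffel h y v w) z) x) => d1.
generalize ('D_v (fun y => bform (h y) (christoffel h y u w) z) x) => d2 -> ->.
generalize (bform (g (F x)) (cov g F (hess g F u w) v x) ('D_z F x)) => c1.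
generalize (bform (g (F x)) (cov g F (hess g F v w) u x) ('D_z F x)) => c2.
generalize (bform (g (F x)) (hess g F v w x) (hess g F u z x)) => c3.
generalize (bform (g (F x)) (hess g F u w x) (hess g F v z x)) => c4.
generalize (bform (h x) (christoffel h x v w) (christoffel h x u z)) => c5.
generalize (bform (h x) (christoffel h x u w) (christoffel h x v z)) => c6.
ring.
Unshelve. all: by end_near. Qed.
End Gauss.

(** * Constant sectional curvature *)

(** A nonzero [P] has fewer than [size P] roots, while the first [size P] natural numbers are
    distinct in [R]. *)
Lemma horner_eq0 (R : realType) (P : {poly R}) : (forall t, P.[t] = 0) -> P = 0.
Proof.
move=> P0; apply/eqP; case: (eqVneq P 0) => // nP.
have := @max_poly_roots _ P [seq i%:R | i <- iota 0 (size P)] nP.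
rewrite size_map size_iota ltnn; apply.
  by apply/allP => t _; rewrite /root P0.
by rewrite map_inj_uniq ?iota_uniq // => i j /eqP; rewrite eqr_nat => /eqP.
Qed.

Definition polynomial_fun (R : realType) (f : R -> R) : Prop :=
  exists P : {poly R}, forall t, f t = P.[t].

Lemma polynomial_fun_cst (R : realType) (a : R) : polynomial_fun (fun=> a).
Proof. by exists a%:P => t; rewrite hornerC. Qed.

Lemma polynomial_fun_affine (R : realType) (f p q : R -> R) :
  (forall t, f t = p t + t * q t) -> polynomial_fun p -> polynomial_fun q ->
  polynomial_fun f.
Proof.
move=> fE [P PE] [Q QE]; exists (P + 'X * Q) => t.
by rewrite fE PE QE !hornerE.
Qed.

Section CurvatureLike.
Variables (R : realType) (n : nat).
Notation V := 'rV[R]_n.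
Implicit Types T : V -> V -> V -> V -> R.

(** Algebraic curvature tensors. Linearity is recorded in the last slot only; the symmetries carry
    it to the others in [curvature_like_linear]. *)
Definition curvature_like T : Prop :=
  [/\ forall u v w z, T u v w z = - T v u w z,
      forall u v w z, T u v w z = - T u v z w,
      forall u v w z, T u v w z + T v w u z + T w u v z = 0
    & forall u v w, linear_for *%R (T u v w)].

(** A linear combination of the Bianchi identities for the four cyclic shifts of the arguments,
    reduced by the two skew-symmetries. *)
Lemma curvature_like_pair T u v w z : curvature_like T -> T u v w z = T w z u v.
Proof.
move=> [a12 a34 b _].
have := b u v w z; have := b v w z u; have := b w z u v; have := b z u v w.
have e1 : T w u v z = - T u w v z by exact: a12.
have e2 : T v w z u = - T v w u z by exact: a34.
have e3 : T w z v u = - T w z u v by exact: a34.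
have e4 : T z v w u = T v z u w by rewrite a12 a34 opprK.
have e5 : T z u w v = T u z v w by rewrite a12 a34 opprK.
have e6 : T u w z v = - T u w v z by exact: a34.
have e7 : T z u v w = - T u z v w by exact: a12.
have e8 : T u v z w = - T u v w z by exact: a34.
rewrite {}e1 {}e2 {}e3 {}e4 {}e5 {}e6 {}e7 {}e8.
move: (T u v w z) (T w z u v) (T u w v z) (T v z u w) (T u z v w) (T v w u z).
by move=> *; lra.
Qed.

Lemma curvature_like_linear T : curvature_like T -> forall a x y,
  [/\ forall v w z, T (a *: x + y) v w z = a * T x v w z + T y v w z,
      forall u w z, T u (a *: x + y) w z = a * T u x w z + T u y w z,
      forall u v z, T u v (a *: x + y) z = a * T u v x z + T u v y z
    & forall u v w, T u v w (a *: x + y) = a * T u v w x + T u v w y].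
Proof.
move=> cT a x y; have [a12 a34 b l] := cT.
have l3 u v z : T u v (a *: x + y) z = a * T u v x z + T u v y z.
  by rewrite a34 l (a34 u v x) (a34 u v y); ring.
have l1 v w z : T (a *: x + y) v w z = a * T x v w z + T y v w z.
  by rewrite !(curvature_like_pair _ v w z cT) l3.
split=> [//|u w z|//|u v w]; last exact: l.
by rewrite (a12 u (a *: x + y)) l1 (a12 u x) (a12 u y); ring.
Qed.

(** Polarizing in the outer and in the inner pair shows that [T] changes sign when its middle
    arguments are exchanged. Together with the skew-symmetries this makes the three Bianchi terms
    equal, so 3 T = 0. *)
Lemma curvature_like_eq0 T : curvature_like T ->
  (forall u v, T u v v u = 0) -> forall u v w z, T u v w z = 0.
Proof.
move=> cT T0; have [a12 a34 b l] := cT.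
have pol u v z : T u v v z = 0.
  have := T0 (1 *: u + z) v; have [l1 _ _ l4] := curvature_like_linear cT 1 u z.
  rewrite l1 !l4 !T0 (curvature_like_pair z _ _ _ cT) (a12 v u) (a34 u v z v).
  by move: (T u v v z) => d; lra.
have pol2 u v w z : T u v w z = - T u w v z.
  have := pol u (1 *: v + w) z; have [_ l2 l3 _] := curvature_like_linear cT 1 v w.
  rewrite l2 !l3 !pol; move: (T u v w z) (T u w v z) => d1 d2; lra.
move=> u v w z; have := b u v w z.
rewrite (pol2 v w) (a12 v u) (a12 w u) (pol2 u w); move: (T u v w z) => d; lra.
Qed.

Lemma curvature_like_line T u v a b : curvature_like T ->
  polynomial_fun (fun t => T (t *: a + u) (t *: b + v) (t *: b + v) (t *: a + u)).
Proof.
move=> cT.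
have L x y t := curvature_like_linear cT t x y.
have P1 y2 y3 y4 : polynomial_fun (fun t => T y2 y3 y4 (t *: a + u)).
  apply: (@polynomial_fun_affine _ _ (fun=> T y2 y3 y4 u) (fun=> T y2 y3 y4 a)) => [t||];
    [by have [_ _ _ ->] := L a u t; rewrite addrC|exact: polynomial_fun_cst..].
have P2 y2 y3 : polynomial_fun (fun t => T y2 y3 (t *: b + v) (t *: a + u)).
  apply: (@polynomial_fun_affine _ _ (fun t => T y2 y3 v (t *: a + u))
    (fun t => T y2 y3 b (t *: a + u))) => [t||] //.
  by have [_ _ -> _] := L b v t; rewrite addrC.
have P3 y2 : polynomial_fun (fun t => T y2 (t *: b + v) (t *: b + v) (t *: a + u)).
  apply: (@polynomial_fun_affine _ _ (fun t => T y2 v (t *: b + v) (t *: a + u))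
    (fun t => T y2 b (t *: b + v) (t *: a + u))) => [t||] //.
  by have [_ -> _ _] := L b v t; rewrite addrC.
apply: (@polynomial_fun_affine _ _ (fun t => T u (t *: b + v) (t *: b + v) (t *: a + u))
    (fun t => T a (t *: b + v) (t *: b + v) (t *: a + u))) => [t||] //.
by have [-> _ _ _] := L a u t; rewrite addrC.
Qed.

(* The nondegenerate planes are Zariski dense: on the line from [(u, v)] to a
   nondegenerate [(a, b)] both tensors are polynomial, and their product vanishes. *)
Lemma curvature_like_eq0_on_nondegenerate T G a b :
  curvature_like T -> curvature_like G -> G a b b a != 0 ->
  (forall u v, G u v v u != 0 -> T u v v u = 0) -> forall u v w z, T u v w z = 0.
Proof.
move=> cT cG Gab TG; apply: curvature_like_eq0 => // u v.
have [P PE] := curvature_like_line u v (a - u) (b - v) cT.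
have [Q QE] := curvature_like_line u v (a - u) (b - v) cG.
have PQ0 : P * Q = 0.
  apply: horner_eq0 => t; rewrite hornerM -PE -QE.
  have [->|/TG ->] := eqVneq (G (t *: (a - u) + u) (t *: (b - v) + v)
    (t *: (b - v) + v) (t *: (a - u) + u)) 0; first exact: mulr0.
  exact: mul0r.
have := QE 1; rewrite !scale1r !subrK => Q1.
have {}PQ0 : P = 0.
  move/eqP: PQ0; rewrite mulf_eq0 => /orP[/eqP //|/eqP Q0].
  by move: Gab; rewrite Q1 Q0 horner0 eqxx.
by have := PE 0; rewrite PQ0 horner0 !scale0r !add0r.
Qed.

Lemma curvature_like_sub T G (c : R) : curvature_like T -> curvature_like G ->
  curvature_like (fun u v w z => T u v w z - c * G u v w z).
Proof.
move=> [a1 a2 a3 a4] [b1 b2 b3 b4]; split.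
- by move=> u v w z; rewrite a1 b1; ring.
- by move=> u v w z; rewrite a2 b2; ring.
- move=> u v w z.
  transitivity ((T u v w z + T v w u z + T w u v z) - c * (G u v w z + G v w u z + G w u v z)).
    by ring.
  by rewrite a3 b3 mulr0 subr0.
- by move=> u v w r x y; rewrite a4 b4; ring.
Qed.

Lemma curvature_like_Gtensor (A : 'M[R]_n) : A^T = A -> curvature_like (Gtensor (bform A)).
Proof.
move=> AT; rewrite /Gtensor /wedge; have C u v := bform_sym u v AT.
split=> [u v w z|u v w z|u v w z|u v w r x y]; try ring.
  by rewrite (C w v) (C w u) (C v u); ring.
by rewrite !(bform_linearr A _ r x y); ring.
Qed.
End CurvatureLike.

Lemma curvature_like_riem (R : realType) (m : nat) (U : set 'rV[R]_m)
    (g : 'rV[R]_m -> 'M[R]_m) x :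
  local_metric U g -> U x -> curvature_like (riem g x).
Proof.
move=> Ug Ux; split=> [u v w z|u v w z|u v w z|u v w].
- exact: (riem_antisym12 Ug).
- exact: (riem_antisym34 Ug).
- exact: (riem_bianchi Ug).
- exact: bform_linearr.
Qed.

(** * Identities between curvature tensors *)

Section TensorIdentities.
Variables (R : realType) (n : nat).
Notation V := 'rV[R]_n.
Implicit Types (f g H K S : V -> V -> R).

Definition symbilinear f : Prop :=
  (forall u v, f u v = f v u) /\ (forall v, linear_for *%R (f ^~ v)).

Lemma symbilinear_subl f a b X Y W : symbilinear f ->
  f (a *: X - b *: Y) W = a * f X W - b * f Y W.
Proof.
move=> [fC fl]; rewrite fl -scaleN1r -[- 1 *: _]addr0 fl -[in f 0 W](scale0r X).
have f0 : f 0 W = 0 by have := fl W (-1) 0 0; rewrite scaler0 addr0 mulN1r addNr.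
by rewrite scale0r f0; have := fl W b Y 0; rewrite addr0 f0 => ->; ring.
Qed.

Lemma symbilinear_subr f a b X Y W : symbilinear f ->
  f W (a *: X - b *: Y) = a * f W X - b * f W Y.
Proof.
by move=> fS; have [fC _] := fS; rewrite fC symbilinear_subl // !(fC W).
Qed.

Section SymmetricForms.
Variables (g H K S S2 : V -> V -> R).
Hypotheses (gs : symbilinear g) (Hs : symbilinear H) (Ks : symbilinear K)
  (Ss : symbilinear S) (S2s : symbilinear S2).

Let gC u v : g u v = g v u. Proof. by case: gs. Qed.
Let HC u v : H u v = H v u. Proof. by case: Hs. Qed.
Let KC u v : K u v = K v u. Proof. by case: Ks. Qed.
Let SC u v : S u v = S v u. Proof. by case: Ss. Qed.
Let S2C u v : S2 u v = S2 v u. Proof. by case: S2s. Qed.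

(** c G + (e/2) H /\ H multiplied out: the halves cancel against the repeated terms of [wedge]. *)
Definition gauss_tensor (c e : R) : V -> V -> V -> V -> R := fun X1 X2 X3 X4 =>
  c * (g X1 X4 * g X2 X3 - g X1 X3 * g X2 X4)
  + e * (H X1 X4 * H X2 X3 - H X1 X3 * H X2 X4).

(** Orders the arguments of the form whose symmetry is [fC], so that equal values become one atom
    for [ring]. *)
Ltac norm_pairs fC X1 X2 X3 X4 X Y :=
  rewrite ?(fC X2 X1) ?(fC X3 X1) ?(fC X4 X1) ?(fC X X1) ?(fC Y X1) ?(fC X3 X2) ?(fC X4 X2)
    ?(fC X X2) ?(fC Y X2) ?(fC X4 X3) ?(fC X X3) ?(fC Y X3) ?(fC X X4) ?(fC Y X4) ?(fC Y X).

(** This is the formula for R.R with Q(g, C) expanded through Q(g, G) = 0. The terms in [t] cancel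
    by Q(H, H /\ H) = 0 and Q(H, G) = - Q(g, g /\ H). The endomorphisms [D] are given by their
    pairings with [g] and [H], which is all that a derivation of this tensor sees. *)
Lemma act_gauss_tensor (c e t N : R) (D : V -> V -> V -> V) X1 X2 X3 X4 X Y :
  (forall X Y Z W, g (D X Y Z) W = gauss_tensor c e X Y Z W) ->
  (forall X Y Z W, H (D X Y Z) W = c * (g Y Z * H X W - g X Z * H Y W)
                                   + e * (H Y Z * K X W - H X Z * K Y W)) ->
  (forall u v, S u v = (N - 1) * c * g u v + e * (t * H u v - K u v)) ->
  act4 D (gauss_tensor c e) X1 X2 X3 X4 X Y
  = Qt S (gauss_tensor c e) X1 X2 X3 X4 X Y
    - (N - 2) * c * Qt g (gauss_tensor c e) X1 X2 X3 X4 X Y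
    + c * Qt g (wedge g S) X1 X2 X3 X4 X Y.
Proof.
move=> Dg DH SE.
have Dg' X' Y' Z W : g W (D X' Y' Z) = gauss_tensor c e X' Y' Z W by rewrite gC.
have DH' X' Y' Z W : H W (D X' Y' Z) = c * (g Y' Z * H X' W - g X' Z * H Y' W)
   + e * (H Y' Z * K X' W - H X' Z * K Y' W) by rewrite HC DH.
rewrite /Qt /act4 /wedge {1 2 3 4}/gauss_tensor !Dg !DH !Dg' !DH' /gauss_tensor.
rewrite !(symbilinear_subl _ _ _ _ _ gs, symbilinear_subl _ _ _ _ _ Hs,
          symbilinear_subr _ _ _ _ _ gs, symbilinear_subr _ _ _ _ _ Hs).
rewrite !SE.
rewrite !(symbilinear_subl _ _ _ _ _ gs, symbilinear_subl _ _ _ _ _ Hs, symbilinear_subl _ _ _ _ _ Ks,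
          symbilinear_subr _ _ _ _ _ gs, symbilinear_subr _ _ _ _ _ Hs, symbilinear_subr _ _ _ _ _ Ks).
norm_pairs gC X1 X2 X3 X4 X Y; norm_pairs HC X1 X2 X3 X4 X Y; norm_pairs KC X1 X2 X3 X4 X Y.
ring.
Qed.

(** The endomorphisms in Q(g, .) are skew for [g], hence annihilate [g] and what is built from
    it. *)
Lemma Qt_Gtensor X1 X2 X3 X4 X Y : Qt g (Gtensor g) X1 X2 X3 X4 X Y = 0.
Proof.
rewrite /Qt /act4 /Gtensor /wedge.
rewrite !(symbilinear_subl _ _ _ _ _ gs, symbilinear_subr _ _ _ _ _ gs).
norm_pairs gC X1 X2 X3 X4 X Y.
ring.
Qed.

(** Polarization of Q(A, A /\ A) = 0 at A = g + r S: the coefficient of r^2 is 2 Q(S, g /\ S) + Q(g,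
    S /\ S). *)
Lemma Qt_wedge_metric X1 X2 X3 X4 X Y :
  Qt S (wedge g S) X1 X2 X3 X4 X Y = - 2^-1 * Qt g (wedge S S) X1 X2 X3 X4 X Y.
Proof.
rewrite /Qt /act4 /wedge.
rewrite !(symbilinear_subl _ _ _ _ _ gs, symbilinear_subr _ _ _ _ _ gs,
  symbilinear_subl _ _ _ _ _ Ss, symbilinear_subr _ _ _ _ _ Ss).
norm_pairs gC X1 X2 X3 X4 X Y; norm_pairs SC X1 X2 X3 X4 X Y.
by field.
Qed.

(** The coefficient of r in the same polarization, 2 Q(g, g /\ S) + Q(S, g /\ g). *)
Lemma Qt_Gtensor_swap X1 X2 X3 X4 X Y :
  Qt S (Gtensor g) X1 X2 X3 X4 X Y = - Qt g (wedge g S) X1 X2 X3 X4 X Y.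
Proof.
rewrite /Qt /act4 /Gtensor /wedge.
rewrite !(symbilinear_subl _ _ _ _ _ gs, symbilinear_subr _ _ _ _ _ gs,
  symbilinear_subl _ _ _ _ _ Ss, symbilinear_subr _ _ _ _ _ Ss).
norm_pairs gC X1 X2 X3 X4 X Y; norm_pairs SC X1 X2 X3 X4 X Y.
by field.
Qed.

(** E.E for E = a g /\ S - b G. Pairing a value of [D] with [S] puts a second Ricci operator on an
    argument, which is where [S2] arises. [D] is skew for [g] and annihilates G, so no term in
    [b * b] appears. *)
Lemma act_wedge (a b : R) (D : V -> V -> V -> V) X1 X2 X3 X4 X Y :
  (forall X Y Z W, g (D X Y Z) W = a * wedge g S X Y Z W - b * Gtensor g X Y Z W) ->
  (forall X Y Z W, S (D X Y Z) W =
     a * (S Y Z * S X W + g Y Z * S2 X W - g X Z * S2 Y W - S X Z * S Y W)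
     - b * (g Y Z * S X W - g X Z * S Y W)) ->
  act4 D (fun Y1 Y2 Y3 Y4 => a * wedge g S Y1 Y2 Y3 Y4 - b * Gtensor g Y1 Y2 Y3 Y4)
    X1 X2 X3 X4 X Y
  = a * a * Qt g (wedge g S2) X1 X2 X3 X4 X Y - a * b * Qt g (wedge g S) X1 X2 X3 X4 X Y.
Proof.
move=> Dg DS.
have Dg' X' Y' Z W : g W (D X' Y' Z) = a * wedge g S X' Y' Z W - b * Gtensor g X' Y' Z W.
  by rewrite gC.
have DS' X' Y' Z W : S W (D X' Y' Z) =
     a * (S Y' Z * S X' W + g Y' Z * S2 X' W - g X' Z * S2 Y' W - S X' Z * S Y' W)
     - b * (g Y' Z * S X' W - g X' Z * S Y' W) by rewrite SC DS.
rewrite /Qt /act4 /Gtensor /wedge !(Dg, DS, Dg', DS') /Gtensor /wedge.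
rewrite !(symbilinear_subl _ _ _ _ _ gs, symbilinear_subl _ _ _ _ _ Ss, symbilinear_subl _ _ _ _ _ S2s,
          symbilinear_subr _ _ _ _ _ gs, symbilinear_subr _ _ _ _ _ Ss, symbilinear_subr _ _ _ _ _ S2s).
norm_pairs gC X1 X2 X3 X4 X Y; norm_pairs SC X1 X2 X3 X4 X Y; norm_pairs S2C X1 X2 X3 X4 X Y.
by field.
Qed.
End SymmetricForms.
End TensorIdentities.

(** Stated for differences, since the endomorphisms of C are those of R minus those of E. *)
Definition quadriadditive (R : realType) (n : nat)
    (T : 'rV[R]_n -> 'rV[R]_n -> 'rV[R]_n -> 'rV[R]_n -> R) : Prop :=
  [/\ forall u v x y z, T (u - v) x y z = T u x y z - T v x y z,
      forall u v x y z, T x (u - v) y z = T x u y z - T x v y z,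
      forall u v x y z, T x y (u - v) z = T x y u z - T x y v z
    & forall u v x y z, T x y z (u - v) = T x y z u - T x y z v].

Section Act4.
Variables (R : realType) (n : nat).
Notation V := 'rV[R]_n.
Implicit Types (T : V -> V -> V -> V -> R) (D : V -> V -> V -> V).

Lemma act4_subl D1 D2 T X1 X2 X3 X4 X Y : quadriadditive T ->
  act4 (fun X Y Z => D1 X Y Z - D2 X Y Z) T X1 X2 X3 X4 X Y
  = act4 D1 T X1 X2 X3 X4 X Y - act4 D2 T X1 X2 X3 X4 X Y.
Proof. by move=> [T1 T2 T3 T4]; rewrite /act4 T1 T2 T3 T4; ring. Qed.

Lemma symbilinear_B (f : V -> V -> R) u v w : symbilinear f ->
  (f (u - v) w = f u w - f v w) * (f w (u - v) = f w u - f w v).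
Proof.
move=> fs; have := symbilinear_subl 1 1 u v w fs.
by have := symbilinear_subr 1 1 u v w fs; rewrite !scale1r !mul1r.
Qed.

Lemma quadriadditive_gauss_tensor (g H : V -> V -> R) c e :
  symbilinear g -> symbilinear H -> quadriadditive (gauss_tensor g H c e).
Proof.
by move=> gs Hs; split=> u v x y z; rewrite /gauss_tensor
  !(symbilinear_B u v _ gs, symbilinear_B u v _ Hs); ring.
Qed.

Lemma quadriadditive_wedge (g S : V -> V -> R) a b :
  symbilinear g -> symbilinear S ->
  quadriadditive (fun Y1 Y2 Y3 Y4 => a * wedge g S Y1 Y2 Y3 Y4 - b * Gtensor g Y1 Y2 Y3 Y4).
Proof.
by move=> gs Ss; split=> u v x y z; rewrite /Gtensor /wedge
  !(symbilinear_B u v _ gs, symbilinear_B u v _ Ss); ring.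
Qed.

Lemma symbilinear_bform (A : 'M[R]_n) : A^T = A -> symbilinear (bform A).
Proof.
by move=> AT; split=> [u v|v]; [exact: bform_sym | exact: bform_linearl].
Qed.
End Act4.

(** All Q(., C) are expanded. The two contributions of Q(g, S /\ S) have coefficients a/2 and - a/2,
    and those of Q(g, g /\ S) match because a^2 k - b = a b. *)
Lemma Qt_combination (R : realType) (n : nat) (g S S2 : 'rV[R]_n -> 'rV[R]_n -> R)
    (T : 'rV[R]_n -> 'rV[R]_n -> 'rV[R]_n -> 'rV[R]_n -> R) (N k c L : R)
    X1 X2 X3 X4 X Y :
  symbilinear g -> symbilinear S -> N - 2 != 0 -> N - 1 != 0 ->
  let a := (N - 2)^-1 in
  let b := k / ((N - 2) * (N - 1)) in
  let C := fun Y1 Y2 Y3 Y4 =>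
    T Y1 Y2 Y3 Y4 - (a * wedge g S Y1 Y2 Y3 Y4 - b * Gtensor g Y1 Y2 Y3 Y4) in
  Qt S T X1 X2 X3 X4 X Y - (N - 2) * c * Qt g T X1 X2 X3 X4 X Y
    + c * Qt g (wedge g S) X1 X2 X3 X4 X Y + L * Qt g C X1 X2 X3 X4 X Y
    - a * a * Qt g (wedge g S2) X1 X2 X3 X4 X Y + a * b * Qt g (wedge g S) X1 X2 X3 X4 X Y
  = Qt S C X1 X2 X3 X4 X Y + (L - (N - 2) * c) * Qt g C X1 X2 X3 X4 X Y
    - ((N - 2) ^+ 2)^-1 * Qt g (fun Y1 Y2 Y3 Y4 => (N - 2) / 2 * wedge S S Y1 Y2 Y3 Y4
        - k * wedge g S Y1 Y2 Y3 Y4 + wedge g S2 Y1 Y2 Y3 Y4) X1 X2 X3 X4 X Y.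
Proof.
move=> gs Ss n2 n1 a b C.
have QC f : Qt f C X1 X2 X3 X4 X Y = Qt f T X1 X2 X3 X4 X Y
      - a * Qt f (wedge g S) X1 X2 X3 X4 X Y + b * Qt f (Gtensor g) X1 X2 X3 X4 X Y.
  rewrite /C; move: a b {C} => a b; rewrite /Qt /act4.
  by move: (wedge g S) (Gtensor g) => W G; ring.
have -> : Qt g (fun Y1 Y2 Y3 Y4 => (N - 2) / 2 * wedge S S Y1 Y2 Y3 Y4
      - k * wedge g S Y1 Y2 Y3 Y4 + wedge g S2 Y1 Y2 Y3 Y4) X1 X2 X3 X4 X Y
    = (N - 2) / 2 * Qt g (wedge S S) X1 X2 X3 X4 X Y
      - k * Qt g (wedge g S) X1 X2 X3 X4 X Y + Qt g (wedge g S2) X1 X2 X3 X4 X Y.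
  rewrite /Qt /act4; move: (wedge g S) (wedge S S) (wedge g S2) => W1 W2 W3.
  by move: ((N - 2) / 2) => d; ring.
rewrite !QC (Qt_Gtensor gs) (Qt_Gtensor_swap gs Ss) (Qt_wedge_metric gs Ss) /a /b.
move: (Qt _ _ _ _ _ _ _ _) (Qt _ _ _ _ _ _ _ _) (Qt _ _ _ _ _ _ _ _) (Qt _ _ _ _ _ _ _ _) => q1 q2 q3 q4.
field.
by rewrite n2.
Qed.

(** * The value of C.R + R.C at a point *)

Section WeylExchange.
Variables (R : realType) (n : nat) (A B : 'M[R]_n) (c e t : R).
Notation V := 'rV[R]_n.
Variables (S : V -> V -> R).
Hypotheses (Au : A \in unitmx) (AT : A^T = A) (BT : B^T = B).

Let g := bform A.
Let H := bform B.
(** The form H^2. The shape operator is right multiplication by [B *m invmx A], and inserting it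
    into one argument of [H] gives this matrix. *)
Definition shape_sq : 'M[R]_n := B *m invmx A *m B.
Let K := bform shape_sq.
Hypothesis SE : forall u v, S u v = (n%:R - 1) * c * g u v + e * (t * H u v - K u v).

Let gs : symbilinear g. Proof. exact: symbilinear_bform. Qed.
Let Hs : symbilinear H. Proof. exact: symbilinear_bform. Qed.
Let Ks : symbilinear K.
Proof.
by apply: symbilinear_bform; rewrite /shape_sq !trmx_mul trmx_inv AT BT mulmxA.
Qed.

Lemma symbilinear_ricci : symbilinear S.
Proof.
have [gC gl] := gs; have [HC Hl] := Hs; have [KC Kl] := Ks; split=> [u v|v a u w].
  by rewrite !SE gC HC KC.
by rewrite !SE gl Hl Kl; ring.
Qed.
Let Ss := symbilinear_ricci.

Let So u : V := sharp A (S u).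

Let gSo u w : g (So u) w = S u w.
Proof.
have [SC Sl] := Ss; rewrite /g bform_sharp // => a x y.
by rewrite !(SC u) Sl.
Qed.

Let S2 u v : R := S (So u) v.

Let S2E u v : S2 u v = g (So u) (So v).
Proof. by have [[gC _] [SC _]] := (gs, Ss); rewrite /S2 SC -gSo gC. Qed.

Let S2s : symbilinear S2.
Proof.
have [[gC gl] [SC Sl]] := (gs, Ss); split=> [u v|v a u w]; first by rewrite !S2E gC.
rewrite /S2.
have -> : So (a *: u + w) = a *: So u + So w.
  by rewrite -sharp_linear; congr sharp; apply/funext => x; rewrite Sl.
exact: Sl.
Qed.

Let sharpE T u : (forall a x y, T (a *: x + y) = a * T x + T y) -> g (sharp A T) u = T u.
Proof. by move=> Tl; apply: bform_sharp. Qed.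

Let Rx := gauss_tensor g H c e.
Let dR X Y Z := sharp A (Rx X Y Z).

Let gR X Y Z W : g (dR X Y Z) W = Rx X Y Z W.
Proof.
apply: sharpE => a x y; have [[gC gl] [HC Hl]] := (gs, Hs).
by rewrite /Rx /gauss_tensor !(gC _ (_ + _)) !(HC _ (_ + _)) !gl !Hl !(gC x) !(gC y)
  !(HC x) !(HC y); ring.
Qed.

Let gshape u w : g u (w *m B *m invmx A) = H u w.
Proof.
have [[gC _] [HC _]] := (gs, Hs).
by rewrite gC HC /g /H /bform mulmxKV.
Qed.

Let Hshape u w : H u (w *m B *m invmx A) = K u w.
Proof. by rewrite /H /K /bform !trmx_mul trmx_inv AT BT /shape_sq !mulmxA. Qed.

(** Pairing with [W] under [H] is pairing with the shape operator of [W] under [g], which moves that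
    operator into the last slot of [Rx]. The Ricci operator plays the same part in [SdE]. *)
Let HR X Y Z W : H (dR X Y Z) W = c * (g Y Z * H X W - g X Z * H Y W)
                                   + e * (H Y Z * K X W - H X Z * K Y W).
Proof. by rewrite -gshape gR /Rx /gauss_tensor !gshape !Hshape; ring. Qed.

Variables (a b : R).
Let E Y1 Y2 Y3 Y4 := a * wedge g S Y1 Y2 Y3 Y4 - b * Gtensor g Y1 Y2 Y3 Y4.
Let dE X Y Z := sharp A (E X Y Z).

Let gE X Y Z W : g (dE X Y Z) W = E X Y Z W.
Proof.
apply: sharpE => r x y; have [[gC gl] [SC Sl]] := (gs, Ss).
by rewrite /E /Gtensor /wedge !(gC _ (_ + _)) !(SC _ (_ + _)) !gl !Sl !(gC x) !(gC y)
  !(SC x) !(SC y); ring.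
Qed.

Let gSo' u w : g u (So w) = S u w.
Proof. by have [[gC _] [SC _]] := (gs, Ss); rewrite gC gSo SC. Qed.
Let SSo' u w : S u (So w) = S2 u w.
Proof. by have [[S2C _] [SC _]] := (S2s, Ss); rewrite SC S2C. Qed.

Let SdE X Y Z W : S (dE X Y Z) W =
     a * (S Y Z * S X W + g Y Z * S2 X W - g X Z * S2 Y W - S X Z * S Y W)
     - b * (g Y Z * S X W - g X Z * S Y W).
Proof.
rewrite -gSo' gE /E /Gtensor /wedge !gSo' !SSo'.
by field.
Qed.

Let C Y1 Y2 Y3 Y4 := Rx Y1 Y2 Y3 Y4 - E Y1 Y2 Y3 Y4.

Let dC X Y Z : sharp A (C X Y Z) = dR X Y Z - dE X Y Z.
Proof.
rewrite addrC -scaleN1r -sharp_linear; congr sharp; apply/funext => W.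
by rewrite /C; ring.
Qed.

(** The hypothesis on C.C is taken at the same six vectors. Substituting it for [L * Qt g C] on the
    right leaves R.R and E.E to evaluate. *)
Lemma cdot_gauss_weyl (L : R) X1 X2 X3 X4 X Y :
  cdot A C C X1 X2 X3 X4 X Y = L * Qt g C X1 X2 X3 X4 X Y ->
  cdot A C Rx X1 X2 X3 X4 X Y + cdot A Rx C X1 X2 X3 X4 X Y
  = Qt S Rx X1 X2 X3 X4 X Y - (n%:R - 2) * c * Qt g Rx X1 X2 X3 X4 X Y
    + c * Qt g (wedge g S) X1 X2 X3 X4 X Y + L * Qt g C X1 X2 X3 X4 X Y
    - a * a * Qt g (wedge g S2) X1 X2 X3 X4 X Y + a * b * Qt g (wedge g S) X1 X2 X3 X4 X Y.
Proof.
have DC T : cdot A C T X1 X2 X3 X4 X Y = act4 (fun X Y Z => dR X Y Z - dE X Y Z) T X1 X2 X3 X4 X Y.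
  by rewrite /cdot /act4 !dC.
have CE D : act4 D C X1 X2 X3 X4 X Y = act4 D Rx X1 X2 X3 X4 X Y - act4 D E X1 X2 X3 X4 X Y.
  by rewrite /act4 /C; ring.
have qR : quadriadditive Rx by exact: quadriadditive_gauss_tensor.
have qE : quadriadditive E by exact: quadriadditive_wedge.
rewrite !DC CE !act4_subl // => CC.
have -> : cdot A Rx C X1 X2 X3 X4 X Y = act4 dR C X1 X2 X3 X4 X Y by [].
rewrite CE.
rewrite -[L * _]CC.
have := act_gauss_tensor gs Hs Ks X1 X2 X3 X4 X Y gR HR SE.
have := act_wedge gs Ss S2s X1 X2 X3 X4 X Y gE SdE.
rewrite -/Rx -/E.
generalize (act4 dR Rx X1 X2 X3 X4 X Y) => r1.
generalize (act4 dE Rx X1 X2 X3 X4 X Y) => r2.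
generalize (act4 dR E X1 X2 X3 X4 X Y) => r3.
generalize (act4 dE E X1 X2 X3 X4 X Y) => r4 -> ->.
generalize (Qt g (wedge g S2) X1 X2 X3 X4 X Y) => q1.
generalize (Qt g (wedge g S) X1 X2 X3 X4 X Y) => q2.
generalize (Qt S Rx X1 X2 X3 X4 X Y) => q3.
generalize (Qt g Rx X1 X2 X3 X4 X Y) => q4.
ring.
Qed.
End WeylExchange.

(** * Ricci tensor and unit normal of a hypersurface *)

Lemma sharp_bform (R : realType) (n : nat) (A : 'M[R]_n) u :
  A \in unitmx -> A^T = A -> sharp A (bform A u) = u.
Proof.
move=> Au AT; apply/eqP; rewrite -subr_eq0; apply/eqP; apply: (bform_eq0 Au) => v.
by rewrite bformBl bform_sharp ?subrr //; exact: bform_linearr.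
Qed.

Lemma bform_matrix (R : realType) (n : nat) (f : 'rV[R]_n -> 'rV[R]_n -> R) :
  (forall v, linear_for *%R (f ^~ v)) -> (forall u, linear_for *%R (f u)) ->
  forall u v, f u v = bform (\matrix_(i, j) f (delta_mx 0 i) (delta_mx 0 j)) u v.
Proof.
move=> f1 f2 u v.
pose l1 v : {linear 'rV[R]_n -> R | *%R} :=
  HB.pack (f ^~ v) (GRing.isLinear.Build R _ _ _ _ (f1 v)).
pose l2 u : {linear 'rV[R]_n -> R | *%R} :=
  HB.pack (f u) (GRing.isLinear.Build R _ _ _ _ (f2 u)).
rewrite bformE {1}(row_sum_delta u) -[f _ _]/(l1 v _) linear_sum.
apply: eq_bigr => i _; rewrite linearZ /=.
rewrite {1}(row_sum_delta v) -[f _ _]/(l2 _ _) linear_sum mulr_sumr.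
by apply: eq_bigr => j _; rewrite linearZ !mxE /= mulrA mulrAC.
Qed.

Lemma mxtrace_lin1_mulmxr (R : realType) (n : nat) (M : 'M[R]_n) (f : 'rV[R]_n -> 'rV[R]_n) :
  (forall z, f z = z *m M) -> \tr (lin1_mx f) = \tr M.
Proof.
by move=> fE; rewrite /mxtrace; apply: eq_bigr => i _; rewrite mxE fE -rowE mxE.
Qed.

(** Nondegeneracy of [g x] identifies z -> R(z, u) v with the matrix [M]. In its trace the scalar
    part gives n c g, the rank one part - c g, the shape operator e tr(H) H, and the last rank one
    part - e H^2. *)
Lemma ricci_gauss_tensor (R : realType) (n : nat) (g : 'rV[R]_n -> 'M[R]_n) x (B : 'M[R]_n)
    (c e : R) :
  g x \in unitmx -> (g x)^T = g x -> B^T = B ->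
  (forall u v w z, riem g x u v w z = gauss_tensor (bform (g x)) (bform B) c e u v w z) ->
  forall u v, ricci g x u v = (n%:R - 1) * c * bform (g x) u v
    + e * (\tr (B *m invmx (g x)) * bform B u v - bform (shape_sq (g x) B) u v).
Proof.
move=> gu gT BT RE u v; set A := g x in gu gT RE *.
pose M : 'M[R]_n := (c * bform A u v)%:M - (c *: (A *m v^T *m u))
  + ((e * bform B u v) *: (B *m invmx A) - e *: (B *m v^T *m u *m B *m invmx A)).
have E z : curvature g x z u v = z *m M.
  apply/eqP; rewrite -subr_eq0; apply/eqP; apply: (bform_eq0 gu) => w.
  rewrite bformBl -[bform _ _ _]/(riem g x z u v w) RE /gauss_tensor.
  apply/eqP; rewrite subr_eq0; apply/eqP.
  have s1 (a : R) C D : bform A (a *: C + D) w = a * bform A C w + bform A D w.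
    exact: bform_linearl.
  have E1 y : y *m v^T *m u = (y *m v^T) 0 0 *: u.
    by rewrite {1}[y *m v^T]mx11_scalar mul_scalar_mx.
  have -> : z *m M = (c * bform A u v) *: z + ((- (c * bform A z v)) *: u +
     ((e * bform B u v) *: (z *m B *m invmx A) + ((- (e * bform B z v)) *: (u *m B *m invmx A) + 0))).
    rewrite /M !mulmxDr mul_mx_scalar -!addrA; congr (_ + _).
    rewrite !mulmxN -!scalemxAr !mulmxA !E1 addr0 -!scalemxAl !scaleNr !scalerA.
    by rewrite /bform.
  rewrite !s1.
  have s2 y : bform A (y *m B *m invmx A) w = bform B y w by rewrite /bform mulmxKV.
  rewrite !s2 (_ : bform A 0 w = 0); last by rewrite /bform !mul0mx mxE.
  by ring.
rewrite /ricci (mxtrace_lin1_mulmxr E) /M.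
rewrite mxtraceD !linearB /= mxtrace_scalar !mxtraceZ.
have t1 (C : 'cV[R]_n) (y : 'rV[R]_n) : \tr (C *m y) = (y *m C) 0 0.
  by rewrite mxtrace_mulC /mxtrace big_ord1.
rewrite -[B *m v^T *m u *m B *m _]mulmxA -[B *m v^T *m u *m _]mulmxA !t1.
rewrite -[(u *m (A *m _)) 0 0]/((u *m (A *m _)) 0 0) mulmxA -/(bform A u v).
have -> : (u *m (B *m invmx A) *m (B *m v^T)) 0 0 = bform (shape_sq A B) u v.
  by rewrite /bform /shape_sq !mulmxA.
rewrite -mulr_natr.
move: (bform A u v) (bform B u v) (bform _ _ _) (\tr _) => a b d t.
ring.
Qed.

Lemma scal_constant_curvature (R : realType) (n : nat) (g : 'rV[R]_n -> 'M[R]_n) x (c : R) :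
  g x \in unitmx -> (g x)^T = g x ->
  (forall u v w z, riem g x u v w z = c * Gtensor (bform (g x)) u v w z) ->
  scal g x = (n%:R - 1) * c * n%:R.
Proof.
move=> gu gT RE.
have ricE u v : ricci g x u v = (n%:R - 1) * c * bform (g x) u v.
  (* Constant curvature is the Gauss tensor with second form 0 and [e = 0]. *)
  rewrite (@ricci_gauss_tensor _ _ g x 0 c 0) ?trmx0 // ?mul0r ?addr0 //.
  move=> y1 y2 y3 y4; rewrite RE /Gtensor /wedge /gauss_tensor; by field.
have opE u : ricci_op g x u = u *m ((n%:R - 1) * c)%:M.
  rewrite mul_mx_scalar -[RHS](sharp_bform _ gu gT) /ricci_op.
  congr sharp; apply/funext => v; by rewrite ricE /bform -!scalemxAl [RHS]mxE.
by rewrite /scal (mxtrace_lin1_mulmxr opE) mxtrace_scalar [RHS]mulr_natr.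
Qed.

Section NormalDecomposition.
Variables (R : realType) (k : nat).
Variables (U : set 'rV[R]_k.+1) (g : 'rV[R]_k.+1 -> 'M[R]_k.+1).
Variables (D : set 'rV[R]_k) (h : 'rV[R]_k -> 'M[R]_k) (F : 'rV[R]_k -> 'rV[R]_k.+1).
Hypotheses (Ug : local_metric U g) (Dh : local_metric D h).
Hypotheses (sF : smooth_on D F) (FD : forall y, D y -> U (F y)).
Hypothesis pull : forall y, D y -> forall v w,
  bform (h y) v w = bform (g (F y)) ('D_v F y) ('D_w F y).
Variables (x : 'rV[R]_k) (xi : 'rV[R]_k.+1).
Hypotheses (Dx : D x) (xiN : unit_normal g F x xi).

Let oD : open D. Proof. by case: Dh. Qed.
Let G := g (F x).
Let GT : G^T = G. Proof. by case: Ug => _ _ e _; apply: e; exact: FD. Qed.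
Let hu : h x \in unitmx. Proof. by case: Dh => _ _ _; exact. Qed.
Let dF : differentiable F x. Proof. exact: (smooth_on_differentiable sF Dx). Qed.
Let e := bform G xi xi.
Let ee : e * e = 1.
Proof. by rewrite /e /G; have [[->|->] _] := xiN; rewrite ?mulrNN mulr1. Qed.

(** In codimension one [xi] and the coordinate tangent vectors form a square matrix [P]. Its Gram
    matrix is block diagonal with invertible blocks [e] and [h x], so [P] and [G] are invertible and
    only 0 is orthogonal to all rows of [P]. *)
Lemma tangent_normal_eq0 a :
  (forall z, bform G a ('D_z F x) = 0) -> bform G a xi = 0 -> a = 0.
Proof.
move=> aF axi; pose P : 'M[R]_(1 + k) := col_mx xi ('J F x).
have JD v : v *m 'J F x = 'D_v F x by rewrite deriveEjacobian.
have PGP : P *m G *m P^T = block_mx e%:M 0 0 (h x).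
  rewrite tr_col_mx mul_col_mx mul_col_row; congr block_mx.
  - by rewrite [LHS]mx11_scalar.
  - apply/rowP => i; rewrite [RHS]mxE -(xiN.2 (delta_mx 0 i)) bform_sym // -JD /bform.
    by rewrite trmx_mul mulmxA trmx_delta -colE [RHS]mxE.
  - apply/colP => i; rewrite [RHS]mxE -(xiN.2 (delta_mx 0 i)) -JD /bform.
    by rewrite -!mulmxA -rowE [RHS]mxE.
  - apply/matrixP => i j; have := pull Dx (delta_mx 0 i) (delta_mx 0 j).
    rewrite -!JD /bform trmx_mul !trmx_delta -!mulmxA -!rowE.
    rewrite !mulmxA -!colE !mxE => ->.
    by [].
have : P *m G *m P^T \in unitmx.
  rewrite PGP unitmxE det_ublock det_scalar1 unitrM -unitmxE hu andbT unitfE.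
  by apply/eqP => e0; move: ee; rewrite e0 mul0r => /eqP; rewrite eq_sym oner_eq0.
rewrite !unitmx_mul => /andP[/andP[_ Gu] PTu].
have aP : a *m G *m P^T = 0.
  rewrite tr_col_mx mul_mx_row -[RHS]row_mx0; congr row_mx.
    by rewrite [LHS]mx11_scalar -/(bform G a xi) axi raddf0.
  apply/rowP => i; rewrite [RHS]mxE -(aF (delta_mx 0 i)) -JD /bform.
  by rewrite trmx_mul mulmxA trmx_delta -colE [RHS]mxE.
by rewrite -[a](mulmxK Gu) -[a *m G](mulmxK PTu) aP !mul0mx.
Qed.

Let B := second_form g F x xi.

Lemma hess_linearl w : linear (fun v => hess g F v w x).
Proof.
have dDF : differentiable ('D_w F) x.
  by apply: (smooth_on_differentiable _ Dx); exact: smooth_on_derive.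
move=> a u v; rewrite /hess /cov (derive_linear dDF) (derive_linear dF).
rewrite (christoffel_linearl Ug _ (FD Dx)).
by rewrite [LHS]addrACA -scalerDr.
Qed.

Lemma second_formE v w : bform B v w = bform G (hess g F v w x) xi.
Proof.
have f1 w' : linear_for *%R (fun v' => bform G (hess g F v' w' x) xi).
  by move=> a y z; rewrite (hess_linearl w') bform_linearl.
have f2 v' : linear_for *%R (fun w' => bform G (hess g F v' w' x) xi).
  move=> a y z; have S t := hess_sym Ug oD sF FD v' t Dx.
  by rewrite (S (a *: y + z)) (S y) (S z); exact: f1.
exact: (esym (bform_matrix (f := fun v w => bform G (hess g F v w x) xi) f1 f2 v w)).
Qed.

Lemma second_form_sym : B^T = B.
Proof.
apply/matrixP => i j.
have E (C : 'M[R]_k) i' j' : C i' j' = bform C (delta_mx 0 i') (delta_mx 0 j').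
  by rewrite /bform trmx_delta -rowE -colE !mxE.
by rewrite mxE !E !second_formE (hess_sym Ug oD sF FD _ _ Dx).
Qed.

(** The Gauss formula at one point: both sides have the same products with the tangent vectors and
    with [xi]. The factor [e] compensates g(xi, xi) = e, as [e * e = 1]. *)
Lemma hess_decomposition v w :
  hess g F v w x = 'D_(christoffel h x v w) F x + (e * bform B v w) *: xi.
Proof.
apply/eqP; rewrite -subr_eq0 opprD addrA; apply/eqP; apply: tangent_normal_eq0 => [z|].
  rewrite !bformBl -(pull_christoffel Ug Dh sF FD pull v w z Dx) -(pull Dx) subrr sub0r.
  have := bform_linearl G ('D_z F x) (e * bform B v w) xi 0.
  rewrite addr0 => ->; rewrite (bform_sym xi _ GT) xiN.2 mulr0 add0r.
  by rewrite /bform !mul0mx mxE oppr0.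
rewrite !bformBl xiN.2 -second_formE subr0.
have := bform_linearl G xi (e * bform B v w) xi 0.
rewrite addr0 => ->; rewrite -/e mulrAC ee mul1r (_ : bform G 0 xi = 0).
  by rewrite addr0 subrr.
by rewrite /bform !mul0mx mxE.
Qed.

Lemma gauss_equation_normal u v w z :
  riem h x u v w z = riem g (F x) ('D_u F x) ('D_v F x) ('D_w F x) ('D_z F x)
  + e * (bform B u z * bform B v w - bform B u w * bform B v z).
Proof.
have E a b c d : bform G (hess g F a b x) (hess g F c d x)
    - bform (h x) (christoffel h x a b) (christoffel h x c d)
    = e * (bform B a b * bform B c d).
  rewrite (pull Dx) !hess_decomposition.
  have := xiN.2 (christoffel h x a b); have := xiN.2 (christoffel h x c d).
  rewrite -/G; move: ('D_(christoffel h x a b) F x) ('D_(christoffel h x c d) F x) => p q.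
  move: (bform B a b) (bform B c d) => r s q0 p0.
  rewrite ![_ + _ *: xi]addrC (bform_linearl G _ (e * r)) !(bform_linearr G _ (e * s)).
  rewrite -/e (bform_sym xi q GT) q0 p0 !mulr0 !addr0 add0r addrK.
  (* The product of the normal parts carries e^3: one factor from each coefficient and one from
     g(xi, xi). *)
  transitivity (e * e * (e * (r * s))); first by ring.
  by rewrite ee mul1r.
apply: (etrans (gauss_equation Ug Dh sF FD pull u v w z Dx)).
move: (E v w u z) (E u w v z); rewrite /G.
generalize (riem g (F x) ('D_u F x) ('D_v F x) ('D_w F x) ('D_z F x)) => T.
move=> E1 E2; apply: (etrans (f_equal2 (fun p q : R => T + p - q) E1 E2)).
move: e; generalize (bform B u z) (bform B v w) (bform B u w) (bform B v z) => p q r s e'.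
clear; ring.
Qed.
End NormalDecomposition.

(** * Charts and the curvature tensor of the ambient space *)

Section Charts.
Variables (R : realType) (n : nat) (M : manifold R n) (g : metric M).
Variables (phi : chart R n M).
Hypothesis phiM : atlas phi.

Lemma chart_image_open (W : set M) : open W ->
  open (phi @` (chart_dom phi `&` W)).
Proof.
move=> oW; have [od oi inv _ cinv] := atlas_chart phiM.
rewrite openE => _ [p [dp Wp] <-].
have pI : (phi @` chart_dom phi) (phi p) by exists p.
have : nbhs (chart_inv phi (phi p)) W by rewrite inv //; exact: open_nbhs_nbhs.
move=> /(cinv _ pI) H.
near=> y.
have [q dq qy] : (phi @` chart_dom phi) y by near: y; exact: open_nbhs_nbhs.
exists q => //; split => //; rewrite -(inv q dq) qy; near: y; exact: H.
Unshelve. all: by end_near. Qed.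

Lemma local_metric_gram (D : set 'rV[R]_n) : open D ->
  D `<=` phi @` chart_dom phi -> local_metric D (g phi).
Proof.
move=> oD Dd; split=> //.
- by move=> s x Dx; apply: (gram_smooth g phiM); exact: Dd.
- by move=> y /Dd[p dp <-]; exact: (gram_sym g phiM dp).
- by move=> y /Dd[p dp <-]; exact: (gram_unit g phiM dp).
Qed.
End Charts.

(** Both tensors agree on nondegenerate planes, and density gives all vectors once one such plane is
    known. It is spanned by the first and last vector of the basis in [has_index], which differ
    because [0 < m]. *)
Lemma riem_constant_curvature (R : realType) (m s : nat) (N : manifold R m.+1)
    (g : metric N) (c : R) :
  (0 < m)%N ->  has_index g s -> has_constant_curvature g c ->
  forall q : N, at_point q (fun psi y => forall u v w z,
    riem (g psi) y u v w z = c * Gtensor (bform (g psi y)) u v w z).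
Proof.
move=> m0 [_ idx] cc q psi psiN dq u v w z.
have [P _ PE] := idx q psi psiN dq.
have dU : (psi @` chart_dom psi) (psi q) by exists q.
have oU : open (psi @` chart_dom psi).
  by have [] := atlas_chart psiN.
have Ug : local_metric (psi @` chart_dom psi) (g psi) by exact: local_metric_gram.
have cR := curvature_like_riem Ug dU.
have gT : (g psi (psi q))^T = g psi (psi q) by exact: (gram_sym g psiN dq).
have cG := curvature_like_Gtensor gT.
apply/eqP; rewrite -subr_eq0; apply/eqP.
have cT := curvature_like_sub c cR cG.
apply: (@curvature_like_eq0_on_nondegenerate _ _ _ _ (row ord0 P) (row ord_max P) cT cG).
  have PB i j : bform (g psi (psi q)) (row i P) (row j P)
      = (P *m g psi (psi q) *m P^T) i j.
    by rewrite /bform !rowE trmx_mul trmx_delta !mulmxA -colE -!mulmxA -rowE !mxE.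
  have ne : (ord0 == ord_max :> 'I_m.+1) = false by apply/negbTE; rewrite -val_eqE neq_ltn m0.
  rewrite /Gtensor /wedge !PB PE !mxE [ord_max == ord0]eq_sym !ne !eqxx !mulr0n !mulr1n.
  (* The signs of the two basis vectors; the Gram determinant of their plane is [a * b]. *)
  set a := (if _ then _ else _); set b := (if _ then _ else _).
  have a1 : a * a = 1 by rewrite /a; case: ifP => _; rewrite ?mulrNN mulr1.
  have b1 : b * b = 1 by rewrite /b; case: ifP => _; rewrite ?mulrNN mulr1.
  apply/eqP => E; have : a * a * (b * b) = 0.
    by rewrite -[RHS](mulr0 (a * b)) -E; field.
  by rewrite a1 b1 mulr1 => /eqP; rewrite oner_eq0.
move=> x y Gn; have := cc q psi psiN dq x y Gn => <-.
by rewrite divfK // subrr.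
Qed.

Theorem theorem3p8 (R : realType) (n s : nat) (c kt : R)
    (M : manifold R n) (N : manifold R n.+1) (g : metric M) (gN : metric N)
    (f : M -> N) (LC : M -> R)
    (n_ge4 : (4 <= n)%N)
    (N_index : has_index gN s)
    (N_curv : has_constant_curvature gN c)
    (N_scal : has_scalar_curvature gN kt)
    (f_imm : isometric_immersion g gN f)
    (M_2qu : quasi_umbilical g gN f 2)
    (LC_def : forall p, UC g p -> at_point p (fun phi x =>
       let C := weyl (g phi) x in
       forall X1 X2 X3 X4 X Y,
         cdot (g phi x) C C X1 X2 X3 X4 X Y
         = LC p * Qt (bform (g phi x)) C X1 X2 X3 X4 X Y)) :
  c = kt / (n * n.+1)%:R /\
  forall p, (US g `&` UC g) p -> at_point p (fun phi x =>
    let gx := bform (g phi x) in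
    let Rx := riem (g phi) x in
    let C := weyl (g phi) x in
    let S := ricci (g phi) x in
    let S2 := ricci_sq (g phi) x in
    let kappa := scal (g phi) x in
    forall X1 X2 X3 X4 X Y,
      cdot (g phi x) C Rx X1 X2 X3 X4 X Y + cdot (g phi x) Rx C X1 X2 X3 X4 X Y
      = Qt S C X1 X2 X3 X4 X Y
        + (LC p - (n%:R - 2) * kt / (n * n.+1)%:R) * Qt gx C X1 X2 X3 X4 X Y
        - ((n%:R - 2) ^+ 2)^-1 *
          Qt gx (fun Y1 Y2 Y3 Y4 =>
                   (n%:R - 2) / 2 * wedge S S Y1 Y2 Y3 Y4
                   - kappa * wedge gx S Y1 Y2 Y3 Y4
                   + wedge gx S2 Y1 Y2 Y3 Y4) X1 X2 X3 X4 X Y).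
Proof.
have riemN (q : N) : at_point q (fun psi y => forall u v w z,
    riem (gN psi) y u v w z = c * Gtensor (bform (gN psi y)) u v w z).
  by apply: riem_constant_curvature N_index N_curv q; exact: leq_trans n_ge4.
(* At some point of [N], tracing c G twice in dimension n + 1 gives the scalar curvature n c (n +
   1). *)
have ckt : c = kt / (n * n.+1)%:R.
  have [q _] := carrier_nonempty N; have [psi psiN dq] := atlas_cover q.
  have gu := gram_unit gN psiN dq; have gT := gram_sym gN psiN dq.
  have := N_scal q psi psiN dq.
  rewrite (scal_constant_curvature gu gT (riemN q psi psiN dq)) => <-.
  have -> : n.+1%:R - 1 = n%:R :> R by rewrite -addn1 natrD addrK.
  rewrite [n%:R * c]mulrC -(mulrA c n%:R n.+1%:R) -natrM mulfK //.
  by rewrite pnatr_eq0 muln_eq0 negb_or /= -lt0n (leq_trans _ n_ge4).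
split=> // p [_ UCp] phi phiM dp gx Rx C S S2 kappa X1 X2 X3 X4 X Y.
have [psi psiN dfp] := atlas_cover (f p).
have [fcont fim] := f_imm.
set x := phi p in gx Rx C S S2 kappa *.
pose F := coord_rep f phi psi.
(* The part of the chart that [f] sends into the domain of [psi]; it is open by continuity of [f],
   and there [F] represents [f]. *)
pose D := phi @` (chart_dom phi `&` f @^-1` chart_dom psi).
pose U := psi @` chart_dom psi.
have [sF imm] := fim phi psi phiM psiN.
have [_ oU _ _ _] := atlas_chart psiN.
have oD : open D.
  apply: chart_image_open => //; apply: open_comp => //.
  by have [] := atlas_chart psiN.
have Fq q : chart_dom phi q -> F (phi q) = psi (f q).
  by move=> dq; rewrite /F /coord_rep /=; have [_ _ -> //] := atlas_chart phiM.
have Dx : D x by exists p.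
have Dh : local_metric D (g phi).
  by apply: local_metric_gram => // _ [q [dq _] <-]; exists q.
have Ug : local_metric U (gN psi) by exact: local_metric_gram.
have FD y : D y -> U (F y).
  by move=> [q [dq dfq] <-]; rewrite Fq //; exists (f q).
have pull y : D y -> forall v w,
    bform (g phi y) v w = bform (gN psi (F y)) ('D_v F y) ('D_w F y).
  move=> Dy v w; have dF := smooth_on_differentiable sF Dy.
  rewrite !(deriveEjacobian _ dF); case: Dy => q [dq dfq] <-.
  rewrite Fq //; have [_ ->] := imm q dq dfq.
  by rewrite /bform trmx_mul !mulmxA.
(* Quasi-umbilicity supplies the unit normal at the point. *)
have [xi [_ [xiN _]]] := M_2qu p phi phiM dp psi psiN dfp.
rewrite -/F -/x in xiN.
set A := g phi x; pose B := second_form (gN psi) F x xi.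
pose e := bform (gN psi (F x)) xi xi.
have Au : A \in unitmx by exact: (gram_unit g phiM dp).
have AT : A^T = A by exact: (gram_sym g phiM dp).
have BT : B^T = B by exact: (second_form_sym Ug Dh sF FD xi Dx).
(* The Gauss equation, in which the ambient tensor c G pulls back to c G of the induced metric. *)
have RE u v w z : Rx u v w z = gauss_tensor gx (bform B) c e u v w z.
  apply: (etrans (gauss_equation_normal Ug Dh sF FD pull Dx xiN u v w z)).
  apply: (f_equal2 +%R); last by apply: (f_equal2 *%R erefl).
  have Fx : F x = psi (f p) by exact: Fq.
  have := riemN (f p) psi psiN dfp ('D_u F x) ('D_v F x) ('D_w F x) ('D_z F x).
  rewrite -Fx => ->; rewrite /Gtensor /wedge.
  have := pull x Dx v z; have := pull x Dx u w; have := pull x Dx v w; have := pull x Dx u z.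
  generalize (bform (gN psi (F x)) ('D_u F x) ('D_z F x)) => b1.
  generalize (bform (gN psi (F x)) ('D_v F x) ('D_w F x)) => b2.
  generalize (bform (gN psi (F x)) ('D_u F x) ('D_w F x)) => b3.
  generalize (bform (gN psi (F x)) ('D_v F x) ('D_z F x)) => b4 <- <- <- <-.
  rewrite -/gx; generalize (gx u z) (gx v w) (gx u w) (gx v z) => c1 c2 c3 c4.
  by clear; field.
have SE u v := ricci_gauss_tensor Au AT BT RE u v.
have RxE : Rx = gauss_tensor gx (bform B) c e by do 4!apply/funext => ?; exact: RE.
(* The coefficients in the definition of the Weyl tensor, so that [E] is R - C. *)
pose a : R := (n%:R - 2)^-1; pose b : R := kappa / ((n%:R - 2) * (n%:R - 1)).
pose E Y1 Y2 Y3 Y4 := a * wedge gx S Y1 Y2 Y3 Y4 - b * Gtensor gx Y1 Y2 Y3 Y4.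
have CE : C = fun Y1 Y2 Y3 Y4 => gauss_tensor gx (bform B) c e Y1 Y2 Y3 Y4 - E Y1 Y2 Y3 Y4.
  apply/funext => Y1; apply/funext => Y2; apply/funext => Y3; apply/funext => Y4.
  by rewrite /C /weyl -[riem _ _ _ _ _ _]/(Rx Y1 Y2 Y3 Y4) RE /E opprB addrA addrAC.
have CC := LC_def p UCp phi phiM dp X1 X2 X3 X4 X Y.
rewrite /= -/x -/C -/gx -/A CE in CC.
have PI := cdot_gauss_weyl Au AT BT SE CC.
rewrite RxE CE.
apply: (etrans PI) => {PI CC CE RxE}.
have n2 : n%:R - 2 != 0 :> R by rewrite subr_eq0 eqr_nat gtn_eqF // (leq_trans _ n_ge4).
have n1 : n%:R - 1 != 0 :> R by rewrite subr_eq0 pnatr_eq1 gtn_eqF // (leq_trans _ n_ge4).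
have -> : (n%:R - 2) * kt / (n * n.+1)%:R = (n%:R - 2) * c by rewrite -mulrA -ckt.
have gs : symbilinear gx by exact: symbilinear_bform.
have Ss : symbilinear S by exact: symbilinear_ricci AT BT SE.
exact: (Qt_combination S2 (gauss_tensor gx (bform B) c e) kappa c (LC p)
  X1 X2 X3 X4 X Y gs Ss n2 n1).
Qed.
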